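(* Let $G$ be a topological group and let $X$ be a minimal $G$-flow. The following are equivalent: (1) The Ellis group $\mathbb{G}_X$, equipped with the tau-topology, is Hausdorff. (2) There are minimal flows $X^*$, $Y$, $Z$ and $G$-maps $\eta\colon X^*\to X$, $\iota\colon X^*\to Z$, and $\sigma\colon Z\to Y$ such that $Y$, $\eta$, and $\iota$ are proximal and $\sigma$ is equicontinuous. (3) There are minimal flows $X^*$, $Y$, $Z$ and $G$-maps $\eta\colon X^*\to X$, $\iota\colon X^*\to Z$, and $\sigma\colon Z\to Y$ such that $Y$ and $\iota$ are proximal and $\sigma$ is equicontinuous (with no further demand on $\eta$). (4) There are minimal ideal flows $X^*$, $Y$, $Z$ and $G$-maps $\eta\colon X^*\to X$, $\iota\colon X^*\to Z$, and $\sigma\colon Z\to Y$ such that $Y$ and $\iota$ are proximal and $\sigma$ is a compact group extension.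
   Context: All topological groups and flows are Hausdorff. A $G$-flow is a compact space with a continuous left $G$-action $G\times X\to X$; it is minimal if every orbit is dense. A subflow is a nonempty closed $G$-invariant subset. A $G$-map is a continuous $G$-equivariant map. The enveloping semigroup of a flow $X$ is $\mathrm{E}(X)=\overline{\{(gx)_{x\in X}:g\in G\}}\subseteq X^X$, which is a $G$-flow; all minimal subflows of $\mathrm{E}(X)$ are isomorphic. For minimal $X$, $M_X$ denotes any minimal flow isomorphic to a minimal subflow of $\mathrm{E}(X)$. A minimal flow $M$ is a minimal ideal flow if for all $x,y\in M$ there is a $G$-flow automorphism $p$ of $M$ such that the pair $(p(x),y)$ is proximal (i.e. there is a net $(g_i)$ in $G$ such that $g_ip(x)$ and $g_iy$ converge to the same point); equivalently, $M\cong M_M$. $M_X$ is always a minimal ideal flow. The Ellis group of a minimal flow $X$ is $\mathbb{G}_X=\mathrm{Aut}(M_X)$, the group of $G$-flow automorphisms of $M=M_X$. The tau-topology on $\mathbb{G}_X$ is the topology with closure operator: for $A\subseteq\mathbb{G}_X$ and $p\in\mathbb{G}_X$, $p\in\mathrm{cl}_\tau(A)$ iff $\{(x,p(x)):x\in M\}\subseteq\overline{\bigcup_{q\in A}\{(x,q(x)):x\in M\}}$ (closure in $M\times M$). It is compact and T1, with separately continuous multiplication and continuous inversion. Let $\phi\colon X\to Y$ be a $G$-map of minimal flows. $\phi$ is proximal if for all $x_0,x_1\in X$ with $\phi(x_0)=\phi(x_1)$ there is a net $(g_i)$ in $G$ such that $g_ix_0$ and $g_ix_1$ converge to the same point. $\phi$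 is equicontinuous if for every entourage $B$ of the unique compatible uniformity of $X$ there is an entourage $A$ such that whenever $(x_0,x_1)\in A$ and $\phi(x_0)=\phi(x_1)$, then $(gx_0,gx_1)\in B$ for every $g\in G$. $\phi$ is a compact group extension if there is a compact Hausdorff topological group $K$ acting continuously on $X$ by $G$-flow automorphisms such that $\phi(x)=\phi(y)$ iff $k(x)=y$ for some $k\in K$. A minimal flow is proximal if its map to a one-point flow is. *)

(* Defs.v *)
From HB Require Import structures.
From mathcomp Require Import all_boot all_classical topology.
Set Implicit Arguments.
Unset Strict Implicit.
Unset Printing Implicit Defensive.
Local Open Scope classical_set_scope.
Local Open Scope relation_scope.

HB.structure Definition PreTopologicalGroup := {G of Topological G & Group G}.

HB.mixin Record PreTopologicalGroup_isTopologicalGroup G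
    & PreTopologicalGroup G := {
  mulg_continuous : continuous (fun gh : G * G => (gh.1 * gh.2)%g) ;
  invg_continuous : continuous (fun g : G => (g^-1)%g) ;
}.

#[short(type="topologicalGroupType")]
HB.structure Definition TopologicalGroup :=
  {G of PreTopologicalGroup G & PreTopologicalGroup_isTopologicalGroup G}.

Definition continuous_action (G : topologicalGroupType) (X : topologicalType)
    (a : G -> X -> X) :=
  [/\ forall x, a 1%g x = x,
      forall g h x, a (g * h)%g x = a g (a h x) &
      continuous (fun gx : G * X => a gx.1 gx.2)].

HB.mixin Record isFlow (G : topologicalGroupType) X & Topological X := {
  act : G -> X -> X ;
  act_continuous_action : continuous_action act ;
  flow_compact : compact [set: X] ;
  flow_hausdorff : hausdorff_space X ;
}.

#[short(type="flowType")]
HB.structure Definition Flow (G : topologicalGroupType) :=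
  {X of Topological X & isFlow G X}.

Definition orbit (G : topologicalGroupType) (X : flowType G) (x : X) : set X :=
  range (fun g : G => act g x).

(* Nonemptiness is the usual convention for flows; without it the empty flow
   would be minimal and would map to every flow. *)
Definition minimal (G : topologicalGroupType) (X : flowType G) :=
  [set: X] !=set0 /\ forall x : X, dense (orbit x).

HB.mixin Record Flow_isMinimal (G : topologicalGroupType) X & Flow G X := {
  minimalP : minimal X ;
}.

#[short(type="minimalFlowType")]
HB.structure Definition MinimalFlow (G : topologicalGroupType) :=
  {X of Flow G X & Flow_isMinimal G X}.

Section FlowTheory.
Context {G : topologicalGroupType}.
Implicit Types X Y : flowType G.

Definition gmap X Y (f : X -> Y) :=
  continuous f /\ forall (g : G) (x : X), f (act g x) = act g (f x).

Definition flow_iso X Y :=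
  exists (f : X -> Y) (h : Y -> X),
    [/\ gmap f, gmap h, cancel f h & cancel h f].

Lemma act1 X (x : X) : act (1%g : G) x = x.
Proof. by have [] := @act_continuous_action G X. Qed.

Lemma actM X (g h : G) (x : X) : act (g * h)%g x = act g (act h x).
Proof. by have [] := @act_continuous_action G X. Qed.

Lemma act_continuous2 X : continuous (fun gx : G * X => act gx.1 gx.2).
Proof. by have [] := @act_continuous_action G X. Qed.

Lemma act_continuous X (g : G) : continuous (act g : X -> X).
Proof.
move=> x; apply: (@continuous_comp X (G * X)%type X (fun x => (g, x))
  (fun gx : G * X => act gx.1 gx.2)).
  by apply: cvg_pair => /=; [exact: cvg_cst|exact: cvg_id].
exact: act_continuous2.
Qed.

Lemma actK X (g : G) : cancel (act g : X -> X) (act g^-1%g).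
Proof. by move=> x; rewrite -actM mulVg act1. Qed.

Lemma actVK X (g : G) : cancel (act g^-1%g : X -> X) (act g).
Proof. by move=> x; rewrite -actM mulgV act1. Qed.

(* Nets are replaced by proper filters on G. *)
Definition proximal_pair X (x y : X) :=
  exists2 F : set_system G, ProperFilter F &
    exists z : X, (act g x @[g --> F] --> z) /\ (act g y @[g --> F] --> z).

Definition proximal_map X (T : Type) (phi : X -> T) :=
  forall x0 x1 : X, phi x0 = phi x1 -> proximal_pair x0 x1.

(* The map to a one-point flow. *)
Definition proximal_flow X := proximal_map (fun _ : X => tt).

End FlowTheory.

Definition diagonal_nbhs (X : topologicalType) : set_system (X * X) :=
  [set A | forall x : X, nbhs (x, x) A].

(* The uniformity compatible with a compact topology is unique. *)
Lemma compact_entourageE (X : uniformType) :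
  compact [set: X] -> @entourage X = @diagonal_nbhs X.
Proof.
move=> cX; apply/seteqP; split=> A.
  move=> /entourage_split_ex[B entB BBA] x.
  exists (xsection B^-1 x, xsection B x) => /=.
    by split; apply: nbhs_entourage => //; exact: entourage_inv.
  by move=> -[y z]/= [/set_mem xy /set_mem xz]; apply: BBA; exists x.
move=> nA.
pose F := filter_from (@entourage X) (fun B => [set E | E `<=` B]).
have FF : Filter F.
  apply: filter_from_filter; first by exists setT; exact: entourageT.
  move=> B C eB eC; exists (B `&` C); first exact: filterI.
  by move=> E EBC; split; apply: subset_trans EBC _ => ? [].
have := (compact_near_coveringP [set: X]).1 cX _ F
  (fun E y => forall z, E (y, z) -> A (y, z)) FF.
case.
  move=> x _; have [[U V] /= [xU xV] UVA] := nA x.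
  have [W entW WUV] : nbhs_ entourage x (U `&` V).
    by rewrite nbhs_entourageE; exact: filterI.
  have [B entB BBW] := entourage_split_ex entW.
  exists (xsection B x, [set E | E `<=` B]) => /=.
    by split; [exact: nbhs_entourage|exists B].
  move=> -[y E]/= [/set_mem xy EB] z /EB yz; apply: UVA; split=> /=.
    apply: (WUV y _).1; apply/mem_set; apply: BBW; exists y => //.
    exact: entourage_refl.
  by apply: (WUV z _).2; apply/mem_set; apply: BBW; exists y.
move=> B entB BP; apply: filterS entB => -[y z].
exact: (BP B (@subset_refl _ B) y Logic.I).
Qed.

Section UniformSpace.
Context {G : topologicalGroupType} (X : flowType G).

(* X with its unique compatible uniformity; an alias, so as not to interfere
   with the uniform structures that product and subset types inherit. *)
Definition uniform_space : Type := X.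
HB.instance Definition _ := Topological.copy uniform_space X.

Local Notation diagonal_nbhs := (@diagonal_nbhs X).

Let diagonal_nbhs_filter : Filter diagonal_nbhs.
Proof.
split=> [x|A B nA nB x|A B AB nA x].
- exact: filterT.
- exact: filterI (nA x) (nB x).
- exact: filterS AB (nA x).
Qed.

Let diagonal_nbhs_diagonal A : diagonal_nbhs A -> diagonal `<=` A.
Proof. by move=> nA [x y]; rewrite /diagonal/= => ->; exact: nbhs_singleton. Qed.

Let diagonal_nbhs_inv A : diagonal_nbhs A -> diagonal_nbhs A^-1.
Proof.
move=> nA x; have [[U V] /= [xU xV] UVA] := nA x.
by exists (V, U) => // -[y z] [Vy Uz]; exact: (UVA (z, y)).
Qed.

Let diagonal_nbhs_split A :
  diagonal_nbhs A -> exists2 B, diagonal_nbhs B & B \; B `<=` A.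
Proof.
move=> nA; apply: contrapT => noB.
pose T := ((X * X) * X)%type.
pose bad (B : set (X * X)) : set T :=
  [set t | [/\ B t.1, B (t.1.2, t.2) & ~ A (t.1.1, t.2)]].
have badP : ProperFilter (filter_from diagonal_nbhs bad).
  apply: filter_from_proper.
    apply: filter_from_filter; first by exists setT; exact: (@filterT _ _ diagonal_nbhs_filter).
    move=> B C nB nC; exists (B `&` C).
      exact: (@filterI _ _ diagonal_nbhs_filter).
    by move=> t [[? ?] [? ?] ?].
  move=> B nB; apply: contrapT => B0; apply: noB; exists B => // -[x z]/=.
  move=> [y Bxy Byz]; apply: contrapT => nAxz.
  by apply: B0; exists ((x, y), z).
have cT : compact [set: T].
  have cX := @flow_compact G X.
  by rewrite -!setXTT; apply: compact_setX => //; apply: compact_setX.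
have [[[x y] z] [_ cl]] := cT _ badP filterT.
have sep (u v : X) : u <> v ->
    exists U V, [/\ nbhs u U, nbhs v V & diagonal_nbhs (~` (U `*` V))].
  move=> uv; have := @flow_hausdorff G X; rewrite open_hausdorff.
  have /eqP uv' := uv.
  move=> /(_ u v uv') [[U V]] /= [/set_mem Uu /set_mem Vv] [oU oV /eqP UV0].
  have regX w : {for w, @regular_space X}.
    by apply: (@compact_regular X w setT);
      [exact: flow_hausdorff|exact: flow_compact|exact: filterT].
  have [U' uU' U'U] := regX u U (open_nbhs_nbhs (conj oU Uu)).
  have cV : closed (~` V) by exact: open_closedC.
  have cU'V w : ~ (closure U' w /\ closure V w).
    move=> [/U'U Uw /(_ U (open_nbhs_nbhs (conj oU Uw)))[q [Vq Uq]]].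
    by have : (U `&` V) q by []; rewrite UV0.
  exists U', V; split=> //; first exact: open_nbhs_nbhs.
  move=> w; have [U'w|nU'w] := pselect (closure U' w).
    have nVw : ~ closure V w by move=> Vw; exact: (cU'V w).
    exists (setT, ~` closure V) => /=.
      split; first exact: filterT.
      apply: open_nbhs_nbhs; split=> //.
      by apply: closed_openC; exact: closed_closure.
    by move=> -[a b]/= [_ nVb] [_ Vb]; apply: nVb; exact: subset_closure.
  exists (~` closure U', setT) => /=.
    split; last exact: filterT.
    apply: open_nbhs_nbhs; split=> //.
    by apply: closed_openC; exact: closed_closure.
  by move=> -[a b]/= [nUa _] [Ua _]; apply: nUa; exact: subset_closure.
have xy : x = y.
  apply: contrapT => /sep[U [V [xU yV nD]]].
  have [||[[a b] c] [[/= + _ _] [[/= Ua Vb] _]]] :=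
    cl (bad (~` (U `*` V))) ((U `*` V) `*` setT).
  - by exists (~` (U `*` V)).
  - exists (U `*` V, setT) => //=; split; last exact: filterT.
    by exists (U, V).
  - by apply.
have yz : y = z.
  apply: contrapT => /sep[U [V [yU zV nD]]].
  have [||[[a b] c] [[/= _ + _] [[/= _ Ub] Vc]]] :=
    cl (bad (~` (U `*` V))) ((setT `*` U) `*` V).
  - by exists (~` (U `*` V)).
  - exists (setT `*` U, V) => //=; split=> //.
    by exists (setT, U) => //; split=> //; exact: filterT.
  - by apply.
subst y z; have [[U V] /= [xU xV] UVA] := nA x.
have [||[[a b] c] [[/= _ _ +] [[/= Ua _] Vc]]] :=
  cl (bad setT) ((U `*` setT) `*` V).
- by exists setT => //; exact: (@filterT _ _ diagonal_nbhs_filter).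
- exists (U `*` setT, V) => //=; split=> //.
  by exists (U, setT) => //; split=> //; exact: filterT.
- by apply; exact: (UVA (a, c)).
Qed.

Let diagonal_nbhsE : nbhs = nbhs_ (diagonal_nbhs : set_system (uniform_space * uniform_space)).
Proof.
apply/funext => x; apply/seteqP; split => [U xU|U]; last first.
  move=> [B nB BU]; apply: filterS BU _.
  have [[V W] /= [xV xW] VWB] := nB x.
  apply: filterS xW => y Wy; apply/mem_set/VWB; split=> //.
  exact: nbhs_singleton xV.
move: xU; rewrite nbhsE => -[U' [oU' U'x] U'U].
have regX : {for x, @regular_space X}.
  by apply: (@compact_regular X x setT);
    [exact: flow_hausdorff|exact: flow_compact|exact: filterT].
have [V xV VU'] := regX U' (open_nbhs_nbhs (conj oU' U'x)).
exists (~` (V `*` ~` U')).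
  move=> w; have [Vw|nVw] := pselect (closure V w).
    exists (setT, U') => /=.
      by split; [exact: filterT|apply: open_nbhs_nbhs; split=> //; exact: VU'].
    by move=> -[a b]/= [_ U'b] [_].
  exists (~` closure V, setT) => /=.
    split; last exact: filterT.
    apply: open_nbhs_nbhs; split=> //.
    by apply: closed_openC; exact: closed_closure.
  by move=> -[a b]/= [nVa _] [Va _]; apply: nVa; exact: subset_closure.
move=> y /set_mem/= nVU; apply: U'U; apply: contrapT => nUy; apply: nVU.
by split=> //; exact: nbhs_singleton xV.
Qed.

HB.instance Definition _ := Nbhs_isUniform.Build uniform_space
  diagonal_nbhs_filter diagonal_nbhs_diagonal diagonal_nbhs_inv
  diagonal_nbhs_split diagonal_nbhsE.

End UniformSpace.

Section Extensions.
Context {G : topologicalGroupType}.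
Implicit Types X Y : flowType G.

Definition equicontinuous_map X (T : Type) (phi : X -> T) :=
  forall B, @entourage (uniform_space X) B ->
    exists2 A, @entourage (uniform_space X) A &
      forall x0 x1 : X, A (x0, x1) -> phi x0 = phi x1 ->
        forall g : G, B (act g x0, act g x1).

(* aut_inv is determined by aut_fun, see flow_autP. *)
Record flow_aut X := FlowAut {
  aut_fun :> X -> X ;
  aut_inv : X -> X ;
  aut_gmap : gmap aut_fun ;
  aut_inv_gmap : gmap aut_inv ;
  aut_funK : cancel aut_fun aut_inv ;
  aut_invK : cancel aut_inv aut_fun ;
}.

HB.instance Definition _ X := gen_eqMixin (flow_aut X).
HB.instance Definition _ X := gen_choiceMixin (flow_aut X).

Lemma flow_autP X (p q : flow_aut X) : (forall x, p x = q x) -> p = q.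
Proof.
case: p q => [p p' ? ? pK p'K] [q q' ? ? qK q'K] /= /funext pq; subst q.
have pq' : p' = q' by apply/funext => x; rewrite -{1}(q'K x) pK.
by subst q'; congr FlowAut; exact: Prop_irrelevance.
Qed.

Lemma gmap_id X : gmap (@id X).
Proof. by split=> // x; exact: cvg_id. Qed.

Lemma gmap_comp X Y (Z : flowType G) (f : Y -> Z) (h : X -> Y) :
  gmap f -> gmap h -> gmap (f \o h).
Proof.
move=> [cf ef] [ch eh]; split=> [x|g x] /=; last by rewrite eh ef.
by apply: continuous_comp; [exact: ch|exact: cf].
Qed.

Definition flow_aut1 X : flow_aut X :=
  FlowAut (@gmap_id X) (@gmap_id X) (fun=> erefl) (fun=> erefl).

Definition flow_autM X (p q : flow_aut X) : flow_aut X :=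
  FlowAut (gmap_comp (aut_gmap p) (aut_gmap q))
    (gmap_comp (aut_inv_gmap q) (aut_inv_gmap p))
    (can_comp (aut_funK p) (aut_funK q)) (can_comp (aut_invK q) (aut_invK p)).

Definition flow_autV X (p : flow_aut X) : flow_aut X :=
  FlowAut (aut_inv_gmap p) (aut_gmap p) (aut_invK p) (aut_funK p).

Let flow_autA X : associative (@flow_autM X).
Proof. by move=> p q r; apply: flow_autP. Qed.
Let flow_aut1g X : left_id (@flow_aut1 X) (@flow_autM X).
Proof. by move=> p; apply: flow_autP. Qed.
Let flow_autg1 X : right_id (@flow_aut1 X) (@flow_autM X).
Proof. by move=> p; apply: flow_autP. Qed.
Let flow_autVg X : left_inverse (@flow_aut1 X) (@flow_autV X) (@flow_autM X).
Proof. by move=> p; apply: flow_autP => x; exact: aut_funK. Qed.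
Let flow_autgV X : right_inverse (@flow_aut1 X) (@flow_autV X) (@flow_autM X).
Proof. by move=> p; apply: flow_autP => x; exact: aut_invK. Qed.

HB.instance Definition _ X := isGroup.Build (flow_aut X)
  (@flow_autA X) (@flow_aut1g X) (@flow_autg1 X) (@flow_autVg X) (@flow_autgV X).

Definition compact_group_extension X (T : Type) (phi : X -> T) :=
  exists (K : topologicalGroupType) (a : K -> X -> X),
    [/\ compact [set: K] /\ hausdorff_space K,
        continuous_action a,
        forall k : K, exists p : flow_aut X, forall x, a k x = p x &
        forall x y : X, phi x = phi y <-> exists k : K, a k x = y].

Definition minimal_ideal_flow (M : minimalFlowType G) :=
  forall x y : M, exists p : flow_aut M, proximal_pair (p x) y.

End Extensions.

Section TauTopology.
Context {G : topologicalGroupType} (M : minimalFlowType G).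

(* When M is a minimal flow isomorphic to a minimal subflow of E(X), this is
   the Ellis group of X; the topology below is the tau-topology, whose closure
   operator is tau_closure by closure_tauE. *)
Definition ellis_group : Type := flow_aut M.
HB.instance Definition _ := Group.copy ellis_group (flow_aut M).

Definition graph (p : ellis_group) : set (M * M) := range (fun x => (x, p x)).

Definition tau_closure (A : set ellis_group) : set ellis_group :=
  [set p | graph p `<=` closure (\bigcup_(q in A) graph q)].

Lemma tau_closureS A B : A `<=` B -> tau_closure A `<=` tau_closure B.
Proof.
move=> AB p pA; apply: subset_trans pA _; apply: closureS.
exact: bigcup_subset.
Qed.

Lemma subset_tau_closure A : A `<=` tau_closure A.
Proof.
by move=> p Ap z pz; apply: subset_closure; exists p.
Qed.

Lemma tau_closureK A : tau_closure (tau_closure A) `<=` tau_closure A.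
Proof.
move=> p pA z /pA; move: z; apply: subset_trans (@closed_closure _ _).
by apply: closureS => z [q qA qz]; exact: qA.
Qed.

Lemma tau_closure0 : tau_closure set0 = set0.
Proof.
rewrite -subset0 => p; rewrite /tau_closure/= bigcup_set0 closure0 => p0.
have [[x _] _] := @minimalP G M.
by apply: (p0 (x, p x)); exists x.
Qed.

Let diag_act_continuous (g : G) :
  continuous (fun z : M * M => (act g z.1, act g z.2)).
Proof.
move=> z; apply: cvg_pair => /=.
- apply: continuous_comp; [exact: cvg_fst|exact: act_continuous].
- apply: continuous_comp; [exact: cvg_snd|exact: act_continuous].
Qed.

Lemma closure_graph_act (A : set ellis_group) (g : G) (z : M * M) :
  let B := \bigcup_(q in A) graph q in
  closure B z -> closure B (act g z.1, act g z.2).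
Proof.
move=> B Bz U zU; have [w [[q Aq [x _ <-]] Uw]] := Bz _ (@diag_act_continuous g z U zU).
exists (act g x, act g (q x)); split=> //.
by exists q => //; exists (act g x) => //; rewrite (aut_gmap q).2.
Qed.

Lemma tau_closureU A B :
  tau_closure (A `|` B) = tau_closure A `|` tau_closure B.
Proof.
apply/seteqP; split=> [p|p []]; last 2 first.
- by apply: tau_closureS => q; left.
- by apply: tau_closureS => q; right.
have prop C x0 : closure (\bigcup_(q in C) graph q) (x0, p x0) ->
    tau_closure C p.
  move=> Cx0 _ [x _ <-]; apply: contrapT => nCx.
  pose U := ~` closure (\bigcup_(q in C) graph q).
  have oU : open ((fun x => (x, p x)) @^-1` U).
    apply: open_comp => [y _|]; last exact/closed_openC/closed_closure.
    by apply: cvg_pair => /=; [exact: cvg_id|exact: (aut_gmap p).1].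
  have [_ /(_ x0)dM] := @minimalP G M.
  have [y [/= Uy [g _ gy]]] := dM _ (ex_intro _ x nCx) oU.
  move: Uy; rewrite -gy (aut_gmap p).2; apply.
  exact: (@closure_graph_act C g (x0, p x0)).
rewrite {1}/tau_closure/= bigcup_setU closureU => pAB.
have [[x0 _] _] := @minimalP G M.
have [|/prop|/prop] := pAB (x0, p x0); first by exists x0.
- by left.
- by right.
Qed.

Definition tau_open : set_system ellis_group :=
  [set U | tau_closure (~` U) `<=` ~` U].

Let tau_openT : tau_open setT.
Proof. by rewrite /tau_open/= setCT tau_closure0. Qed.

Let tau_openI : setI_closed tau_open.
Proof. by move=> U V oU oV; rewrite /tau_open/= setCI tau_closureU; exact: setUSS. Qed.

Let tau_open_bigU (I : Type) (f : I -> set ellis_group) :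
  (forall i, tau_open (f i)) -> tau_open (\bigcup_i f i).
Proof.
move=> of_ p pf [i _ fip]; apply: (of_ i p _ fip).
by apply: tau_closureS pf; apply: subsetC; exact: bigcup_sup.
Qed.

HB.instance Definition _ :=
  isOpenTopological.Build ellis_group tau_openT tau_openI tau_open_bigU.

Lemma closure_tauE (A : set ellis_group) : closure A = tau_closure A.
Proof.
apply/seteqP; split.
  rewrite closureE; apply: smallest_sub; last exact: subset_tau_closure.
  rewrite /= -openC; change (tau_open (~` tau_closure A)).
  by rewrite /tau_open/= setCK; exact: tau_closureK.
have : open (~` closure A) by apply: closed_openC; exact: closed_closure.
move=> oA; change (tau_open (~` closure A)) in oA.
move: oA; rewrite /tau_open/= setCK; apply: subset_trans.
by apply: tau_closureS; exact: subset_closure.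
Qed.

End TauTopology.

Section Subflow.
Context {G : topologicalGroupType} (X : flowType G).

Record subflow := Subflow {
  subflow_set :> set X ;
  subflow_neq0 : subflow_set !=set0 ;
  subflow_closed : closed subflow_set ;
  subflow_act : forall (g : G) x, subflow_set x -> subflow_set (act g x) ;
}.

Variable S : subflow.

Definition subflow_type : Type := set_type S.
HB.instance Definition _ := Topological.copy subflow_type (set_type S).

Let val_continuous : continuous (val : subflow_type -> X).
Proof. exact: (@initial_continuous (set_type S) X val). Qed.

Let subact (g : G) (x : subflow_type) : subflow_type :=
  SigSub (mem_set (subflow_act g (set_valP x))).

Let subact_continuous_action : continuous_action subact.
Proof.
split=> [x|g h x|].
- by apply/val_inj; exact: act1.
- by apply/val_inj; exact: actM.
apply: (@continuous_comp_initial _ _ _ (val : subflow_type -> X)) => -[g x].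
apply: (@continuous_comp _ _ _ (fun gx : G * subflow_type => (gx.1, val gx.2))
  (fun gx : G * X => act gx.1 gx.2)); last exact: act_continuous2.
apply: cvg_pair => /=; first exact: cvg_fst.
have cv : continuous (fun gx : G * subflow_type => val gx.2 : X).
  by move=> y; apply: (@continuous_comp _ _ _ snd (val : subflow_type -> X));
    [exact: cvg_snd|exact: val_continuous].
exact: (cv (g, x)).
Qed.

Let subflow_compact : compact [set: subflow_type].
Proof.
move=> F FF _; pose vF : set_system X := (val : subflow_type -> X) @ F.
have cS : compact S.
  exact: subclosed_compact (@subflow_closed S) (@flow_compact G X) _.
have vFS : vF S by apply: (@filterS _ F _ setT) => [y _|]; [exact: set_valP|exact: filterT].
have [x [Sx Fx]] := cS vF (fmap_proper_filter _ FF) vFS.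
exists (SigSub (mem_set Sx) : subflow_type); split=> // A B FA [C [[D oD <-] /= Dx] DB].
have vFA : vF ((val : subflow_type -> X) @` A).
  by apply: (@filterS _ F _ A) => // y Ay; exists y.
have [_ [[y Ay <-] Dy]] := Fx _ D vFA (open_nbhs_nbhs (conj oD Dx)).
by exists y; split=> //; exact: DB.
Qed.

Let subflow_hausdorff : hausdorff_space subflow_type.
Proof.
move=> p q pq; apply/val_inj; apply: (@flow_hausdorff G X) => A B pA qB.
have [y [Ay By]] := pq _ _ (val_continuous pA) (val_continuous qB).
by exists (val y).
Qed.

HB.instance Definition _ := isFlow.Build G subflow_type
  subact_continuous_action subflow_compact subflow_hausdorff.

End Subflow.

Section EnvelopingSemigroup.
Context {G : topologicalGroupType} (X : flowType G).

(* The flow X^X: product topology, G acting on the values. *)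
Definition selfmaps : Type := {ptws X -> X}.
HB.instance Definition _ := Topological.copy selfmaps {ptws X -> X}.

Let selfmaps_act (g : G) (f : selfmaps) : selfmaps := fun x => act g (f x).

Let selfmaps_continuous_action : continuous_action selfmaps_act.
Proof.
split=> [f|g h f|].
- by apply/funext => x; exact: act1.
- by apply/funext => x; exact: actM.
have cx x : continuous (fun gf : G * selfmaps => act gf.1 (gf.2 x)).
  move=> [g f].
  apply: (@continuous_comp _ _ _ (fun gf : G * selfmaps => (gf.1, gf.2 x))
    (fun gx : G * X => act gx.1 gx.2)); last exact: act_continuous2.
  apply: cvg_pair => /=; first exact: cvg_fst.
  have cv : continuous (fun gf : G * selfmaps => gf.2 x : X).
    move=> y; apply: (@continuous_comp _ _ _ snd (fun f : selfmaps => f x)).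
      exact: cvg_snd.
    exact: (@proj_continuous {classic X} (fun=> X) x).
  exact: (cv (g, f)).
move=> [g f]; apply/cvg_sup => x U [_ [[W oW <-] /= Wx] WU].
rewrite nbhs_filterE; apply: filterS WU _; apply: (cx x (g, f)).
exact: open_nbhs_nbhs.
Qed.

Let selfmaps_compact : compact [set: selfmaps].
Proof.
have := @tychonoff {classic X} (fun=> X) (fun=> setT) (fun=> @flow_compact G X).
by congr (compact _); apply/seteqP; split.
Qed.

Let selfmaps_hausdorff : hausdorff_space selfmaps.
Proof.
exact: (@hausdorff_product {classic X} (fun=> X) (fun=> @flow_hausdorff G X)).
Qed.

HB.instance Definition _ := isFlow.Build G selfmaps
  selfmaps_continuous_action selfmaps_compact selfmaps_hausdorff.

Definition enveloping_set : set selfmaps :=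
  closure (range (fun g : G => (fun x => act g x) : selfmaps)).

Let enveloping_neq0 : enveloping_set !=set0.
Proof.
by exists (fun x => act (1%g : G) x); apply: subset_closure; exists 1%g.
Qed.

Let enveloping_closed : closed enveloping_set.
Proof. exact: closed_closure. Qed.

Let enveloping_act (g : G) (f : selfmaps) :
  enveloping_set f -> enveloping_set (act g f).
Proof.
move=> Ef U gfU; have [_ [[h _ <-] Uh]] := Ef _ (@act_continuous G selfmaps g f _ gfU).
exists (act g ((fun x => act h x) : selfmaps)); split=> //.
by exists (g * h)%g => //; apply/funext => x; exact: actM.
Qed.

Definition enveloping_semigroup : subflow selfmaps :=
  Subflow enveloping_neq0 enveloping_closed enveloping_act.

(* M is a version of M_X; exists_ideal_flow below shows that there is one. *)
Definition is_ideal_flow_of (M : flowType G) :=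
  exists S : subflow (subflow_type enveloping_semigroup),
    minimal (subflow_type S) /\ flow_iso M (subflow_type S).

End EnvelopingSemigroup.

Section Existence.
Context {G : topologicalGroupType}.

Lemma exists_minimal_subflow (X : flowType G) :
  [set: X] !=set0 -> exists S : subflow X, minimal (subflow_type S).
Proof.
move=> X0.
pose P : set (set X) := [set U | [/\ closed (~` U), ~` U !=set0 &
  forall (g : G) x, (~` U) x -> (~` U) (act g x)]].
have [F FP Ftot|A [[cA A0 actA] Amax]] := @Zorn_bigcup X P.
  split=> [||g x].
  - by rewrite setC_bigcup; apply: closed_bigI => U /FP[].
  - have [->|/set0P[U0 FU0]] := eqVneq F set0; first by rewrite bigcup_set0 setC0.
    pose C := filter_from F (fun U => ~` U).
    have CF : ProperFilter C.
      apply: filter_from_proper; last by move=> U /FP[].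
      apply: filter_from_filter; first by exists U0.
      move=> U V FU FV; have [UV|VU] := Ftot _ _ FU FV.
        by exists V => // x nVx; split=> // /UV.
      by exists U => // x nUx; split=> // /VU.
    have [x [_ Cx]] := @flow_compact G X C CF filterT.
    exists x => -[U FU Ux]; have [cU _ _] := FP _ FU.
    suff : (~` U) x by [].
    by apply: cU => V xV; apply: Cx => //; exists U.
  - rewrite setC_bigcup => Fx U FU; have [_ _ actU] := FP _ FU.
    exact/actU/Fx.
exists (Subflow A0 cA actA).
split; first by have [x Ax] := A0; exists (SigSub (mem_set Ax)).
move=> x O [y Oy] [W oW WO].
pose C := closure (orbit (val x)).
have CA : C `<=` ~` A.
  apply: (subset_trans _ cA); apply: closureS => _ [g _ <-].
  exact/actA/(set_valP x).
have PC : P (~` C).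
  rewrite /P/= setCK; split; first exact: closed_closure.
    by exists (val x); apply: subset_closure; exists 1%g => //; exact: act1.
  move=> g z /contrapT Cz; apply; move=> U gzU.
  have [_ [[h _ <-] Uh]] := Cz _ (@act_continuous G X g z U gzU).
  by exists (act g (act h (val x))); split=> //; exists (g * h)%g => //; exact: actM.
have CE : ~` A `<=` C.
  move=> z nAz; apply: contrapT => nCz; apply: (Amax (~` C)) => //.
  split; first by move=> w Aw /CA.
  by move=> /(_ z nCz).
have Wy : W (val y) by move: Oy; rewrite -WO.
have [_ [[g _ <-] Wg]] := CE _ (set_valP y) W (open_nbhs_nbhs (conj oW Wy)).
exists (act g x); split; last by exists g.
by rewrite -WO.
Qed.

Lemma exists_ideal_flow (X : flowType G) :
  exists M : minimalFlowType G, is_ideal_flow_of X M.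
Proof.
have [S minS] : exists S : subflow (subflow_type (enveloping_semigroup X)),
    minimal (subflow_type S).
  apply: exists_minimal_subflow.
  have [f Ef] := subflow_neq0 (enveloping_semigroup X).
  by exists (SigSub (mem_set Ef)).
pose M : minimalFlowType G :=
  HB.pack (subflow_type S) (Flow_isMinimal.Build _ _ minS).
exists M, S; split=> //.
by exists id, id; split=> //; exact: gmap_id.
Qed.

End Existence.

(* Main.v *)
Require Import Defs.
From HB Require Import structures.
From mathcomp Require Import all_boot all_classical topology.
Set Implicit Arguments.
Unset Strict Implicit.
Unset Printing Implicit Defensive.
Local Open Scope classical_set_scope.

(* A G-map between minimal ideal flows induces a closed continuous surjection
   of automorphism groups, injective when the map is proximal. If sigma is an
   extension of a proximal flow by a compact group K, then Aut(Z) is a quotient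
   of K, and Aut(M) is in turn a closed continuous image of K, hence Hausdorff.

   Conversely, let (x, y) lie in the closure of the union of the graphs of
   Aut(M). If Aut(M) is Hausdorff, there is exactly one p with (p x, y)
   proximal, and this p is a continuous G-invariant function of (x, y). It is a
   cocycle on a proximal extension of M on which the relation above becomes an
   equivalence relation; such an extension is obtained from the orbit closure
   of an Aut(M)-orbit in the hyperspace of M. Dividing by the pairs where p fixes
   a given map M -> X gives Z, and dividing by all pairs gives Y.

   If sigma : Z -> Y is equicontinuous and Y proximal, the maximal quotient Z' of
   the minimal ideal flow of X* separated by G-maps to Z is distal over Y, so
   that Aut(Z') acts transitively on fibers; evaluation at a point identifies
   Aut(Z') with a fiber and makes it a compact group. *)

(** * Compact Hausdorff spaces, ultrafilters and closed maps *)

Section Topology.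

(** [U] is not known to be Hausdorff, so closedness of [f] has to be a hypothesis. The fibers over
    [u] and [v] are disjoint closed sets; normality of [T] separates them, and complements of images
    of closed sets serve as neighborhoods. *)
Lemma closed_onto_hausdorff (T U : topologicalType) (f : T -> U) :
  compact [set: T] -> hausdorff_space T -> continuous f ->
  (forall C, closed C -> closed (f @` C)) -> (forall u, exists t, f t = u) ->
  hausdorff_space U.
Proof.
move=> cT hT cf clf sf.
have pt (u : U) : closed [set u].
  have [t <-] := sf u; rewrite -image_set1; apply: clf.
  exact/accessible_closed_set1/hausdorff_accessible.
have fib (u : U) : closed (f @^-1` [set u]) by apply: preimage_closed => // x _; exact: cf.
move=> u v uv; apply: contrapT => nuv.
have [N N1 N2] :
    filter_from (set_nbhs (f @^-1` [set u])) closure (~` (f @^-1` [set v])).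
  apply: (compact_normal hT cT (fib u)) => x /= fx; apply: open_nbhs_nbhs.
  split; first exact: closed_openC.
  by move=> /= fv; apply: nuv; rewrite -fx -fv.
move: N1 => /set_nbhsP[O [oO uO ON]].
have cO : closed (f @` (~` O)) by apply: clf; exact: open_closedC.
have cN : closed (f @` closure N) by apply: clf; exact: closed_closure.
have [||z [nz1 nz2]] := uv (~` (f @` (~` O))) (~` (f @` closure N)).
- apply: open_nbhs_nbhs; split; first exact: closed_openC.
  by move=> [t nO ft]; apply/nO/uO.
- apply: open_nbhs_nbhs; split; first exact: closed_openC.
  by move=> [t /N2 + ft]; apply.
have [t tz] := sf z; apply: nz2; exists t => //; apply/subset_closure/ON.
by apply: contrapT => nO; apply: nz1; exists t.
Qed.

Lemma closed_eq (T U : topologicalType) (f f' : T -> U) :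
  hausdorff_space U -> continuous f -> continuous f' ->
  closed [set t | f t = f' t].
Proof.
move=> hU cf cf' t ct; apply: hU => A B fA fB.
have /ct[s [/= fs [As Bs]]] : nbhs t (f @^-1` A `&` f' @^-1` B).
  by apply: filterI; [exact: cf|exact: cf'].
by exists (f s); split=> //; rewrite /= fs.
Qed.

Lemma ultra_fmap (T U : Type) (f : T -> U) (F : set_system T) :
  UltraFilter F -> UltraFilter (f @ F).
Proof.
move=> FU; split; first exact: fmap_proper_filter.
move=> F' F'P FF'; apply/seteqP; split=> // A FA.
have [//|nFA] := in_ultra_setVsetC (f @^-1` A) FU.
have /FF' nA : (f @ F) (~` A) by [].
by have [x [Ax]] := filter_ex (filterI FA nA).
Qed.

Lemma compactT_setX (T U : topologicalType) :
  compact [set: T] -> compact [set: U] -> compact [set: T * U].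
Proof. by move=> cT cU; rewrite -setXTT; exact: compact_setX. Qed.

Lemma hausdorff_setX (T U : topologicalType) :
  hausdorff_space T -> hausdorff_space U -> hausdorff_space (T * U)%type.
Proof.
move=> hT hU [t u] [t' u'] c; congr pair.
- apply: hT => A B nA nB; have [||[a b] [[/= ? _] [/= ? _]]] := c (A `*` setT) (B `*` setT).
  + by exists (A, setT) => //; split=> //; exact: filterT.
  + by exists (B, setT) => //; split=> //; exact: filterT.
  + by exists a.
- apply: hU => A B nA nB; have [||[a b] [[/= _ ?] [/= _ ?]]] := c (setT `*` A) (setT `*` B).
  + by exists (setT, A) => //; split=> //; exact: filterT.
  + by exists (setT, B) => //; split=> //; exact: filterT.
  + by exists b.
Qed.

Lemma closed_image (T U : topologicalType) (f : T -> U) (C : set T) :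
  compact [set: T] -> hausdorff_space U -> continuous f -> closed C ->
  closed (f @` C).
Proof.
move=> cT hU cf cC; apply: compact_closed => //; apply: continuous_compact.
  exact: continuous_subspaceT.
exact: subclosed_compact cC cT _.
Qed.

Lemma pair_continuous (T U V : topologicalType) (f : T -> U) (h : T -> V) :
  continuous f -> continuous h -> continuous (fun t => (f t, h t)).
Proof. by move=> cf ch t; apply: cvg_pair => //=; [exact: cf|exact: ch]. Qed.

Lemma fst_continuous (U V : topologicalType) :
  continuous (fst : U * V -> U).
Proof. by move=> z; exact: cvg_fst. Qed.

Lemma snd_continuous (U V : topologicalType) :
  continuous (snd : U * V -> V).
Proof. by move=> z; exact: cvg_snd. Qed.

Lemma comp_continuous (T U V : topologicalType) (f : T -> U) (h : U -> V) :
  continuous f -> continuous h -> continuous (h \o f).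
Proof. by move=> cf ch t; apply: continuous_comp; [exact: cf|exact: ch]. Qed.

Lemma closure_pair (T U : topologicalType) (A : set (T * U)) t u :
  (forall V W, nbhs t V -> nbhs u W -> exists z, [/\ A z, V z.1 & W z.2]) ->
  closure A (t, u).
Proof.
move=> H B [[V W] /= [tV uW] VWB].
by have [z [Az Vz Wz]] := H V W tV uW; exists z; split=> //; exact: VWB.
Qed.

Lemma closed_cvg2 (I : Type) (T U : topologicalType) (F : set_system I)
    (A : set (T * U)) (u : I -> T) (v : I -> U) (t : T) (w : U) :
  ProperFilter F -> closed A -> (forall i, A (u i, v i)) ->
  u i @[i --> F] --> t -> v i @[i --> F] --> w -> A (t, w).
Proof.
move=> FF cA uvA ut vw.
apply: (@closed_cvg _ _ F _ (fun i => (u i, v i)) A cA _ (t, w)).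
  exact: nearW.
exact: cvg_pair.
Qed.

End Topology.

(** * Proximality and the tau-topology *)

Section Dynamics.
Context {G : topologicalGroupType}.
Implicit Types X Y : flowType G.
Implicit Types M W : minimalFlowType G.

Lemma flow_ultra_cvg X (T : Type) (F : set_system T) (f : T -> X) :
  UltraFilter F -> exists l : X, f t @[t --> F] --> l.
Proof.
move=> /(@ultra_fmap T X f) FU.
have := @flow_compact G X; rewrite compact_ultra => /(_ _ FU filterT).
by move=> [l [_ fl]]; exists l.
Qed.

Lemma gmap_cvg X Y (f : X -> Y) (F : set_system G) x l : Filter F ->
  gmap f -> (act g x @[g --> F] --> l) -> (act g (f x) @[g --> F] --> f l).
Proof.
move=> FF [cf ef] xl; under eq_fun do rewrite -ef.
by apply: (@continuous_cvg _ _ _ F FF (fun g => act g x) f) => //; exact: cf.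
Qed.

Lemma flow_cvg_unique X (T : Type) (F : set_system T) (f : T -> X) (l l' : X) :
  ProperFilter F -> f t @[t --> F] --> l -> f t @[t --> F] --> l' -> l = l'.
Proof.
move=> FF fl fl'.
exact: (@cvg_unique X (@flow_hausdorff G X) (f t @[t --> F]) _ l l' fl fl').
Qed.

Lemma proximal_ultra X (x y : X) : proximal_pair x y ->
  exists2 F : set_system G, UltraFilter F & exists z : X,
    (act g x @[g --> F] --> z) /\ (act g y @[g --> F] --> z).
Proof.
move=> [F FF [z [xz yz]]]; have [F' [F'U FF']] := ultraFilterLemma FF.
exists F' => //; exists z; split.
- by move=> A /xz; exact: FF'.
- by move=> A /yz; exact: FF'.
Qed.

Lemma proximal_refl X (x : X) : proximal_pair x x.
Proof.
exists (principal_filter (1%g : G)); first exact: principal_filter_proper.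
by exists x; split=> A xA; apply/principal_filterP; rewrite /= act1; exact: nbhs_singleton.
Qed.

Lemma proximal_sym X (x y : X) : proximal_pair x y -> proximal_pair y x.
Proof. by move=> [F FF [z [xz yz]]]; exists F => //; exists z. Qed.

Lemma proximal_gmap X Y (f : X -> Y) x y :
  gmap f -> proximal_pair x y -> proximal_pair (f x) (f y).
Proof.
by move=> gf [F FF [z [xz yz]]]; exists F => //; exists (f z); split; exact: gmap_cvg.
Qed.

(** The working form of minimality: the complement of [C] is open and misses the orbit of a point of
    [C]. A closed invariant property thus needs checking at one point only. *)
Lemma closed_invariant_full W (C : set W) : closed C ->
  (forall (g : G) w, C w -> C (act g w)) -> C !=set0 -> forall w, C w.
Proof.
move=> cC iC [w0 Cw0] w; apply: contrapT => nCw.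
have [_ /(_ w0)d] := @minimalP G W.
have [z [nCz [g _ gz]]] := d (~` C) (ex_intro _ w nCw) (closed_openC cC).
by apply: nCz; rewrite -gz; exact: iC.
Qed.

Lemma gmap_eq W X (f f' : W -> X) w0 :
  gmap f -> gmap f' -> f w0 = f' w0 -> f =1 f'.
Proof.
move=> [cf ef] [cf' ef'] f0.
apply: (@closed_invariant_full W [set w | f w = f' w]); last by exists w0.
  by apply: closed_eq => //; exact: flow_hausdorff.
by move=> g w /=; rewrite ef ef' => ->.
Qed.

(** Along an ultrafilter sending [f w] and [f' w] to one point, [act g w] converges as well, and the
    two maps agree at its limit. *)
Lemma gmap_proximal_eq W X (f f' : W -> X) w :
  gmap f -> gmap f' -> proximal_pair (f w) (f' w) -> f =1 f'.
Proof.
move=> gf gf' /proximal_ultra[F FU [z [fz f'z]]].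
have [l wl] := flow_ultra_cvg (fun g : G => act g w) FU.
apply: (@gmap_eq _ _ f f' l) => //.
rewrite -(flow_cvg_unique _ fz (gmap_cvg _ gf wl)).
exact: flow_cvg_unique f'z (gmap_cvg _ gf' wl).
Qed.

Lemma gmap_surj X W (f : X -> W) (x : X) : gmap f -> forall w, exists x, f x = w.
Proof.
move=> [cf ef] w.
suff [x' _ <-] : range f w by exists x'.
apply: (@closed_invariant_full W (range f)); last by exists (f x); exists x.
- by apply: closed_image closedT => //; [exact: flow_compact|exact: flow_hausdorff].
- by move=> g _ [y _ <-]; exists (act g y).
Qed.

Definition point_of W : W := projT1 (cid (@minimalP G W).1).

(** [q] makes [w] proximal to a point of the [f]-fiber over [f' w], and G-maps preserve proximal
    pairs. *)
Lemma factor_through_aut W M (f f' : W -> M) : minimal_ideal_flow W ->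
  gmap f -> gmap f' -> exists q : flow_aut W, f' =1 f \o q.
Proof.
move=> mW gf gf'; pose w := point_of W.
have [w' w'E] := gmap_surj w gf (f' w).
have [q qw] := mW w w'; exists q; apply/fsym.
apply: (@gmap_proximal_eq _ _ _ _ w) => //.
  exact: gmap_comp gf (aut_gmap q).
by rewrite -w'E; exact: (proximal_gmap gf qw).
Qed.

Lemma aut_through_factor W M (f f' : W -> M) : minimal_ideal_flow M ->
  gmap f -> gmap f' -> exists q : flow_aut M, f' =1 q \o f.
Proof.
move=> mM gf gf'; pose w := point_of W.
have [q qw] := mM (f w) (f' w); exists q; apply/fsym.
by apply: (@gmap_proximal_eq _ _ _ _ w) => //; exact: gmap_comp (aut_gmap q) gf.
Qed.

Lemma gmap_proximal_flow_eq W Y (f f' : W -> Y) :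
  proximal_flow Y -> gmap f -> gmap f' -> f =1 f'.
Proof.
move=> pY gf gf'; apply: (@gmap_proximal_eq _ _ _ _ (point_of W)) => //.
exact: pY.
Qed.

End Dynamics.

(** * Automorphism groups with the tau-topology *)

Section Tau.
Context {G : topologicalGroupType}.
Implicit Types M : minimalFlowType G.

Definition graphs_closure M (A : set (ellis_group M)) : set (M * M) :=
  closure (\bigcup_(q in A) graph q).

Lemma graphs_closure_graph M (A : set (ellis_group M)) (p : ellis_group M) x :
  A p -> graphs_closure A (x, p x).
Proof. by move=> Ap; apply: subset_closure; exists p => //; exists x. Qed.

Lemma graphs_closure_act M (A : set (ellis_group M)) (g : G) x y :
  graphs_closure A (x, y) -> graphs_closure A (act g x, act g y).
Proof. exact: (@closure_graph_act G M A g (x, y)). Qed.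

(** Although the tau-closure asks for the whole graph of [p], one point suffices: the set of good
    [y] is closed and invariant. *)
Lemma graphs_closure_closure M (A : set (ellis_group M)) (p : ellis_group M) x :
  graphs_closure A (x, p x) -> closure A p.
Proof.
move=> Axp; rewrite closure_tauE => _ [y _ <-]; move: y.
apply: (@closed_invariant_full _ _ [set y | graphs_closure A (y, p y)]).
- apply: (@preimage_closed _ _ (fun y => (y, p y))); last exact: closed_closure.
  by move=> y _; apply: pair_continuous => // ?; [exact: cvg_id|exact: (aut_gmap p).1].
- by move=> g y /=; rewrite (aut_gmap p).2; exact: graphs_closure_act.
- by exists x.
Qed.

(** A net bringing [p x] and [y] together moves [(x, y)] to a point [(w, p w)] of the graph of [p],
    within the closed invariant set [graphs_closure A]. *)
Lemma proximal_graphs_closure M (A : set (ellis_group M)) (p : ellis_group M) x y :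
  graphs_closure A (x, y) -> proximal_pair (p x) y -> closure A p.
Proof.
move=> Axy /proximal_ultra[F FU [z [pxz yz]]].
have [w xw] := flow_ultra_cvg (fun g : G => act g x) FU.
have pw := flow_cvg_unique _ pxz (gmap_cvg _ (aut_gmap p) xw).
apply: (@graphs_closure_closure _ _ _ w); rewrite -pw.
apply: (@closed_cvg _ _ F _ (fun g => (act g x, act g y)) (graphs_closure A)).
- exact: closed_closure.
- by apply: nearW => g; exact: graphs_closure_act.
- exact: cvg_pair.
Qed.

(** Evaluation at [x] gives a cluster point [y] in [M]; any [p] with [p x] proximal to [y] is then a
    cluster point in the group. *)
Lemma tau_compact M : minimal_ideal_flow M -> compact [set: ellis_group M].
Proof.
move=> mM F FF _; pose x := point_of M.
have FF' : ProperFilter ((fun p : ellis_group M => p x) @ F).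
  exact: fmap_proper_filter.
have [y [_ Fy]] := @flow_compact G M _ FF' filterT.
have [p pxy] := mM x y.
exists p; split=> //; rewrite clusterE => A FA.
apply: proximal_graphs_closure pxy.
apply: closure_pair => V W xV yW.
have [|_ [[q Aq <-] Wq]] := Fy ((fun p : ellis_group M => p x) @` A) W _ yW.
  by apply: (@filterS _ F _ A) => // q Aq; exists q.
by exists (x, q x); split=> //; [exists q => //; exists x|exact: nbhs_singleton].
Qed.

Lemma aut_eq M (p q : ellis_group M) (x : M) : p x = q x -> p = q.
Proof.
by move=> pq; apply: flow_autP; apply: gmap_eq pq; exact: aut_gmap.
Qed.

Definition induces M1 M2 (f : M1 -> M2)
    (h : ellis_group M1 -> ellis_group M2) := 
  forall (p : ellis_group M1) x, f (p x) = h p (f x).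

Section Induced.
Variables (M1 M2 : minimalFlowType G) (f : M1 -> M2).
Hypotheses (mM1 : minimal_ideal_flow M1) (mM2 : minimal_ideal_flow M2).
Hypothesis gf : gmap f.

Lemma exists_induced : exists h, induces f h.
Proof.
have H (p : ellis_group M1) : exists q : ellis_group M2, forall x, f (p x) = q (f x).
  have [q qE] := aut_through_factor mM2 gf (gmap_comp gf (aut_gmap p)).
  by exists q => x; exact: qE.
by exists (fun p : ellis_group M1 => projT1 (cid (H p))) => p x; case: cid => q /=.
Qed.

Variable h : ellis_group M1 -> ellis_group M2.
Hypothesis fh : induces f h.

Lemma induced_surj q : exists p, h p = q.
Proof.
have [p pE] := factor_through_aut mM1 gf (gmap_comp (aut_gmap q) gf).
exists p; pose x := point_of M1; apply: (@aut_eq _ _ _ (f x)).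
by rewrite -fh -[f (p x)]pE.
Qed.

Let ff_continuous : continuous (fun z : M1 * M1 => (f z.1, f z.2)).
Proof.
apply: pair_continuous.
- by apply: (comp_continuous (@fst_continuous M1 M1)); exact: gf.1.
- by apply: (comp_continuous (@snd_continuous M1 M1)); exact: gf.1.
Qed.

Lemma induced_continuous : continuous h.
Proof.
apply/continuous_closedP => C cC; rewrite closure_id; apply/seteqP.
split; first exact: subset_closure.
rewrite closure_tauE => p pC; apply: cC.
pose x := point_of M1; apply: (@graphs_closure_closure _ _ _ (f x)).
rewrite -fh => U fxU.
have nU : nbhs (x, p x) ((fun z : M1 * M1 => (f z.1, f z.2)) @^-1` U).
  exact: (@ff_continuous (x, p x)).
have [|_ [[q /= Cq [y _ <-]] Uy]] := pC (x, p x) _ _ nU; first by exists x.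
exists (f y, f (q y)); split=> //.
by exists (h q) => //; exists (f y) => //; rewrite fh.
Qed.

(** The image of [graphs_closure C] in the square of [M2] is closed and contains the graphs of all
    [h p] with [p] in [C]. A lift [(x1, x2)] of a point of the graph of [q] yields [p] in [C] with
    [p x1] proximal to [x2]; pushing this pair forward by [f] shows [h p = q]. *)
Lemma induced_closed C : closed C -> closed (h @` C).
Proof.
move=> cC; rewrite closure_id; apply/seteqP; split; first exact: subset_closure.
rewrite closure_tauE => q qC; pose x := point_of M1.
pose D := (fun z : M1 * M1 => (f z.1, f z.2)) @` graphs_closure C.
have cD : closed D.
  apply: closed_image => //; last exact: closed_closure.
  - by apply: compactT_setX; exact: flow_compact.
  - by apply: hausdorff_setX; exact: flow_hausdorff.
have [[x1 x2] Cx [fx1 fx2]] : D (f x, q (f x)).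
  suff : graphs_closure (h @` C) `<=` D by apply; apply: qC; exists (f x).
  apply: subset_trans cD; apply: closureS => _ [_ [p Cp <-] [y _ <-]].
  have [y' <-] := gmap_surj x gf y.
  by exists (y', p y'); [exact: graphs_closure_graph|rewrite -fh].
have [p px] := mM1 x1 x2.
exists p; first by apply: cC; exact: proximal_graphs_closure px.
have pq : f \o p =1 q \o f.
  apply: (@gmap_proximal_eq _ _ _ _ _ x1).
  - exact: gmap_comp gf (aut_gmap p).
  - exact: gmap_comp (aut_gmap q) gf.
  - by rewrite /= fx1 -fx2; exact: proximal_gmap.
by apply: (@aut_eq _ _ _ (f x)); rewrite -fh [f (p x)]pq.
Qed.

End Induced.
End Tau.

(** Preimages of closed sets are projections of closed parts of the graph in a compact product. *)
Lemma closed_graph_continuous (T U : topologicalType) (f : T -> U) :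
  compact [set: T] -> hausdorff_space T -> compact [set: U] ->
  closed [set z : T * U | z.2 = f z.1] -> continuous f.
Proof.
move=> cT hT cU cf; apply/continuous_closedP => C cC.
have -> : f @^-1` C = fst @` ([set z : T * U | z.2 = f z.1] `&` snd @^-1` C).
  apply/seteqP; split => [t Ct|_ [[t u] /= [-> Ct] <-] //].
  by exists (t, f t).
apply: closed_image => //; first exact: compactT_setX.
  exact: fst_continuous.
apply: closedI => //; apply: preimage_closed => // z _; exact: snd_continuous.
Qed.

Lemma selfmaps_continuous (G : topologicalGroupType) (X : flowType G)
    (T : topologicalType) (h : T -> selfmaps X) :
  (forall x, continuous (fun t => h t x)) -> continuous h.
Proof.
move=> ch t; apply/cvg_sup => x U [_ [[W oW <-] /= Wx] WU].
rewrite nbhs_filterE; apply: filterS WU _; apply: (ch x t).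
exact: open_nbhs_nbhs.
Qed.

(** * Minimal left ideals of the enveloping semigroup *)

Section Ideal.
Context {G : topologicalGroupType}.

(* A minimal left ideal of the enveloping semigroup of X, with elements of M
   acting on X through e. *)
Definition ideal_action (X : flowType G) (M : minimalFlowType G)
    (e : M -> X -> X) :=
  [/\ forall x, gmap (fun m => e m x),
      forall m m', e m =1 e m' -> m = m',
      forall m, exists2 F : set_system G, ProperFilter F &
        forall x, act g x @[g --> F] --> e m x &
      forall m r, exists t, e t =1 e m \o e r].

Lemma ideal_flow_action (X : flowType G) (M : minimalFlowType G) :
  is_ideal_flow_of X M -> exists e : M -> X -> X, ideal_action e.
Proof.
move=> [S [_ [i [j [gi gj ij ji]]]]].
pose v (t : subflow_type S) : selfmaps X := val (val t).
have cv : continuous v.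
  apply: comp_continuous.
    exact: (@initial_continuous (set_type S) (subflow_type (enveloping_semigroup X)) val).
  exact: (@initial_continuous (set_type (enveloping_semigroup X)) (selfmaps X) val).
have pr (x : X) : continuous (fun f : selfmaps X => f x).
  exact: (@proj_continuous {classic X} (fun=> X) x).
have va g t : v (act g t) = act g (v t) by [].
have ve t : enveloping_set (v t) by exact: set_valP.
exists (fun m => v (i m)); split.
- move=> x; split=> [|g m]; last by rewrite gi.2 va.
  exact: (comp_continuous (comp_continuous gi.1 cv) (pr x)).
- move=> m m' mm'; rewrite -(ij m) -(ij m'); congr j.
  by do 2!apply/val_inj; apply/funext.
- move=> m; have := ve (i m); rewrite /enveloping_set closureEcvg.
  move=> [F FF [Fm rF]].
  pose a (g : G) : selfmaps X := fun x => act g x.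
  (* The filter on selfmaps is pulled back to [G]; it stays proper because [F] contains the set of
     translations. *)
  pose H := filter_from F (fun A => a @^-1` A).
  have HF : ProperFilter H.
    apply: filter_from_proper; last first.
      move=> A FA; have [f [Af [g _ gf]]] :=
        filter_ex (filterI FA (rF _ (@subset_refl _ _))).
      by exists g; rewrite /preimage/= /a; move: Af; rewrite -gf.
    apply: filter_from_filter; first by exists setT; exact: filterT.
    by move=> A B FA FB; exists (A `&` B) => //; exact: filterI.
  exists H => // x U xU; exists [set f : selfmaps X | U (f x)]; last by [].
  exact/Fm/(pr x).
- move=> m r.
  (* The selfmaps whose composite with [v (i r)] stays in the ideal form a closed set containing all
     translations, hence the whole enveloping semigroup. *)
  pose C := [set f : selfmaps X | range v (f \o v (i r))].
  have cC : closed C.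
    have crv : closed (range v).
      by apply: closed_image closedT => //; [exact: flow_compact|exact: flow_hausdorff].
    apply: (@preimage_closed _ _ (fun f : selfmaps X => (f \o v (i r) : selfmaps X))) => //.
    by move=> f _; apply: selfmaps_continuous => x; exact: pr.
  have CE : @enveloping_set G X `<=` C.
    apply: (subset_trans _ cC); apply: closureS => _ [g _ <-].
    by exists (act g (i r)).
  have [t _ tE] := CE _ (ve (i m)).
  by exists (j t) => x; rewrite ji tE.
Qed.

Section IdealAction.
Variables (X : flowType G) (M : minimalFlowType G) (e : M -> X -> X).
Hypothesis ea : ideal_action e.

Let egmap : forall x, gmap (fun m => e m x). Proof. by case: ea. Qed.
Let einj : forall m m', e m =1 e m' -> m = m'. Proof. by case: ea. Qed.
Let elim : forall m, exists2 F : set_system G, ProperFilter F &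
  forall x, act g x @[g --> F] --> e m x. Proof. by case: ea. Qed.
Let ecomp : forall m r, exists t, e t =1 e m \o e r. Proof. by case: ea. Qed.

Definition ideal_mul (m r : M) : M := projT1 (cid (ecomp m r)).
Local Infix "**" := ideal_mul (at level 40).

Lemma ideal_mulE m r x : e (m ** r) x = e m (e r x).
Proof. by rewrite /ideal_mul; case: cid => t /= ->. Qed.

Let mA m r s : m ** (r ** s) = (m ** r) ** s.
Proof. by apply: einj => x; rewrite !ideal_mulE. Qed.

Lemma ideal_mul_gmap r : gmap (fun m => m ** r).
Proof.
split; last first.
  move=> g m; apply: einj => x.
  by rewrite ideal_mulE !(egmap _).2 ideal_mulE.
apply: closed_graph_continuous; [exact: flow_compact|exact: flow_hausdorff|
  exact: flow_compact|].
have -> : [set z : M * M | z.2 = z.1 ** r] =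
    \bigcap_(x in [set: X]) [set z | e z.2 x = e z.1 (e r x)].
  apply/seteqP; split => [[m n] /= -> x _ /=|[m n] /= H]; first by rewrite ideal_mulE.
  by apply: einj => x; rewrite ideal_mulE; exact: H.
apply: closed_bigI => x _; apply: closed_eq; first exact: flow_hausdorff.
- exact: (comp_continuous (@snd_continuous M M) (egmap x).1).
- exact: (comp_continuous (@fst_continuous M M) (egmap (e r x)).1).
Qed.

(** One filter serves both actions: refined to an ultrafilter it converges on [M] too, and the maps
    [e _ x] identify the limit. *)
Lemma ideal_limit m : exists2 F : set_system G, ProperFilter F &
  (forall x, act g x @[g --> F] --> e m x) /\
  (forall r, act g r @[g --> F] --> m ** r).
Proof.
have [F0 F0F F0m] := elim m.
have [F [FU F0F']] := ultraFilterLemma F0F.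
have Fm x : act g x @[g --> F] --> e m x by move=> A /F0m; exact: F0F'.
exists F; first by exact: ultra_proper.
split=> // r; have [l rl] := flow_ultra_cvg (fun g : G => act g r) FU.
suff <- : l = m ** r by [].
apply: einj => x; rewrite ideal_mulE.
exact: flow_cvg_unique (gmap_cvg _ (egmap x) rl) (Fm _).
Qed.

Let cmul_eq x r : closed [set m | m ** r = x].
Proof.
apply: closed_eq; [exact: flow_hausdorff|exact: (ideal_mul_gmap r).1|].
by move=> m; exact: cvg_cst.
Qed.

(** The Ellis-Numakura argument, carried out in the closed subsemigroup [D] of all [m] with
    [m ** x = x]. *)
Lemma ideal_idempotent (x : M) : exists2 u, u ** u = u & u ** x = x.
Proof.
pose D := [set m | m ** x = x].
(* Zorn's lemma is applied to unions, so a subsemigroup is recorded by the part [U] removed from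
   [D]; a maximal [U] leaves a minimal closed subsemigroup. *)
pose P : set (set M) := [set U | [/\ closed (D `\` U), D `\` U !=set0 &
  forall m n, (D `\` U) m -> (D `\` U) n -> (D `\` U) (m ** n)]].
have mulD m n : D m -> D n -> D (m ** n) by rewrite /D/= -mA => Dm ->.
have [F FP Ftot|A [[cA [u uA] mulA] Amax]] := @Zorn_bigcup M P.
  have [->|/set0P[U0 FU0]] := eqVneq F set0.
    rewrite bigcup_set0 /P/= setD0; split; [exact: cmul_eq| |
      by move=> m n [Dm _] [Dn _]; split=> //; exact: mulD].
    by have [m mx] := gmap_surj x (ideal_mul_gmap x) x; exists m.
  have DF : D `\` \bigcup_(U in F) U = \bigcap_(U in F) (D `\` U).
    apply/seteqP; split=> [y [Dy nFy] U FU|y Fy]; last first.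
      split; first by have [] := Fy _ FU0.
      by move=> [U FU Uy]; have [] := Fy _ FU.
    by split=> // Uy; apply: nFy; exists U.
  rewrite /P/= DF; split.
  - by apply: closed_bigI => U /FP[].
  - pose C := filter_from F (fun U => D `\` U).
    have CF : ProperFilter C.
      apply: filter_from_proper; last by move=> U /FP[].
      apply: filter_from_filter; first by exists U0.
      move=> U V FU FV; have [UV|VU] := Ftot _ _ FU FV.
        by exists V => // y [Dy nVy]; split=> //; split=> // /UV.
      by exists U => // y [Dy nUy]; split=> //; split=> // /VU.
    have [y [_ Cy]] := @flow_compact G M C CF filterT.
    exists y => U FU; have [cU _ _] := FP _ FU.
    by apply: cU => V yV; apply: Cy => //; exists U.
  - move=> m n Fm Fn.
    suff : (\bigcap_(U in F) (D `\` U)) (m ** n) by rewrite -DF.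
    have {}Fm : (\bigcap_(U in F) (D `\` U)) m by rewrite -DF.
    have {}Fn : (\bigcap_(U in F) (D `\` U)) n by rewrite -DF.
    move=> U FU; have [_ _ mulU] := FP _ FU.
    by apply: mulU; [exact: Fm|exact: Fn].
have minA B : B `<=` D `\` A -> closed B -> B !=set0 ->
    (forall m n, B m -> B n -> B (m ** n)) -> D `\` A `<=` B.
  move=> BA cB B0 mB m [Dm nAm]; apply: contrapT => nBm.
  have DB : D `\` ~` B = B.
    by rewrite setDE setCK; apply/seteqP; split=> [z []|z Bz] //; have [] := BA z Bz.
  apply: (Amax (~` B)); last by rewrite /P /mkset DB.
  split; first by move=> z Az /BA[].
  by move=> /(_ m nBm).
(* By minimality, translation by [u] gives the whole subsemigroup back, so [t ** u = u] for some [t]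
   in it. The [m] with [m ** u = u] then form a closed subsemigroup, again everything, so [u] is
   among them. *)
have Au : D `\` A `<=` (fun m => m ** u) @` (D `\` A).
  apply: minA.
  - by move=> _ [m Am <-]; exact: mulA.
  - apply: (closed_image (@flow_compact G M) (@flow_hausdorff G M)) cA.
    exact: (ideal_mul_gmap u).1.
  - by exists (u ** u); exists u.
  - move=> _ _ [m Am <-] [n An <-]; exists (m ** u ** n); last by rewrite !mA.
    by apply: (mulA) => //; exact: mulA.
have [t At tu] := Au _ uA.
exists u; last by have [] := uA.
suff : D `\` A `<=` (D `\` A) `&` [set m | m ** u = u] by move=> /(_ u uA)[].
apply: minA; first by move=> ? [].
- by apply: closedI => //; exact: cmul_eq.
- by exists t.
- by move=> m n [Am mu] [An nu]; split; [exact: mulA|rewrite /= -mA nu].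
Qed.

Lemma ideal_mulR (u m : M) : u ** u = u -> m ** u = m.
Proof.
move=> uu; have [n <-] := gmap_surj u (ideal_mul_gmap u) m.
by rewrite -mA uu.
Qed.

(** Every [x] lies in a group whose identity is an idempotent fixing [x]. The left inverse [y] is
    two-sided because it has a left inverse [w] in turn, and [x = w ** u]. *)
Let inverse (x : M) : exists v y, [/\ v ** v = v, v ** x = x, y ** x = v & x ** y = v].
Proof.
have [u uu ux] := ideal_idempotent x.
have [y' y'x] := gmap_surj u (ideal_mul_gmap x) u.
pose y := u ** y'.
have yx : y ** x = u by rewrite /y -mA y'x uu.
have [w wy] := gmap_surj u (ideal_mul_gmap y) u.
have xwu : x = w ** u by rewrite -{1}ux -{1}wy -mA yx.
have uy : u ** y = y by rewrite /y mA uu.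
by exists u, y; split=> //; rewrite xwu -mA uy wy.
Qed.

(** Right multiplication by [r] is an automorphism sending [x] to [v ** y] with [v] idempotent; a
    net of translations tending to [v] takes both [v ** y] and [y] to [v ** y]. *)
Lemma ideal_action_minimal_ideal : minimal_ideal_flow M.
Proof.
move=> x y; have [v [x' [vv vx x'x xx']]] := inverse x.
pose r := x' ** y.
have [w [r' [ww wr r'r rr']]] := inverse r.
have RK : cancel (fun m => m ** r) (fun m => m ** r').
  by move=> m; rewrite -mA rr' ideal_mulR.
have RVK : cancel (fun m => m ** r') (fun m => m ** r).
  by move=> m; rewrite -mA r'r ideal_mulR.
exists (FlowAut (ideal_mul_gmap r) (ideal_mul_gmap r') RK RVK) => /=.
rewrite mA xx'; have [F FF [_ Fv]] := ideal_limit v.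
exists F => //; exists (v ** y); split; last exact: Fv.
by rewrite -{2}vv -mA; exact: Fv.
Qed.
End IdealAction.
End Ideal.

(** * Hyperspaces and products *)

Section Hyperspace.
Context {G : topologicalGroupType} (X : flowType G).

Record hyperspace := Hyperspace {
  hyper_set :> set X ;
  hyper_closed : closed hyper_set ;
}.

HB.instance Definition _ := gen_eqMixin hyperspace.
HB.instance Definition _ := gen_choiceMixin hyperspace.

Lemma hyperspaceP (B C : hyperspace) : B `<=>` C -> B = C.
Proof.
case: B C => [B cB] [C cC] /= /seteqP BC; subst C; congr Hyperspace.
exact: Prop_irrelevance.
Qed.

(* The Vietoris topology: (true, O) stands for "contained in O" and
   (false, O) for "meets O". *)
Definition vietoris_subbase (i : bool * set X) : set hyperspace :=
  if i.1 then [set B | B `<=` i.2] else [set B | B `&` i.2 !=set0].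

HB.instance Definition _ := @isSubBaseTopological.Build hyperspace
  (bool * set X)%type [set i | open i.2] vietoris_subbase.

Lemma vietoris_subbase_open i : open i.2 -> open (vietoris_subbase i).
Proof.
move=> oi; exists [set vietoris_subbase i]; last by rewrite bigcup_set1.
by move=> _ ->; exact: (@finI_from1 _ _ [set i | open i.2] vietoris_subbase).
Qed.

Lemma vietoris_cvg (F : set_system hyperspace) (B : hyperspace) : Filter F ->
  (forall O, open O -> B `<=` O -> F [set C : hyperspace | C `<=` O]) ->
  (forall O, open O -> B `&` O !=set0 -> F [set C : hyperspace | C `&` O !=set0]) ->
  F --> B.
Proof.
move=> FF FO FM A; rewrite nbhsE => -[_ [[D sD <-] [C DC CB]] DA].
rewrite nbhs_filterE; apply: filterS DA _; apply: (@filterS _ _ _ C).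
  by move=> E CE; exists C.
have [D' D'o CE] := sD _ DC; rewrite -CE; apply: filter_bigI => -[b O] D'i.
have := D'o _ D'i; rewrite inE /= => oO.
move: CB; rewrite -CE => /(_ _ D'i); rewrite /vietoris_subbase.
by case: b {D'i} => /=; [exact: FO|exact: FM].
Qed.

Let regular (x : X) : {for x, @regular_space X}.
Proof.
by apply: (@compact_regular X x setT);
  [exact: flow_hausdorff|exact: flow_compact|exact: filterT].
Qed.

Lemma hyper_near_meet (B : hyperspace) x O : hyper_set B x -> nbhs x O ->
  \forall C \near B, hyper_set C `&` O !=set0.
Proof.
move=> Bx; rewrite nbhsE => -[V [oV Vx] VO].
have : nbhs B (vietoris_subbase (false, V)).
  apply: open_nbhs_nbhs; split; first exact: vietoris_subbase_open.
  by exists x.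
by apply: filterS => C [y [Cy Vy]]; exists y; split=> //; exact: VO.
Qed.

Lemma hyper_near_miss (B : hyperspace) x : ~ hyper_set B x ->
  exists2 V, nbhs x V & \forall C \near B, forall y, V y -> ~ hyper_set C y.
Proof.
move=> nBx.
have [|V xV VB] := @regular x (~` B).
  by apply: open_nbhs_nbhs; split=> //; exact/closed_openC/hyper_closed.
exists V => //.
have : nbhs B (vietoris_subbase (true, ~` closure V)).
  apply: open_nbhs_nbhs; split.
    by apply: vietoris_subbase_open; exact/closed_openC/closed_closure.
  by move=> y By /= /VB; apply.
by apply: filterS => C CV y Vy /CV; apply; exact: subset_closure.
Qed.

(** The limit of an ultrafilter [F] is the set [L] of points whose every neighborhood is met by
    [F]-almost all sets. If [L] lies in [O], each point outside [O] has a neighborhood missed by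
    almost all sets, uniformly by compactness of the complement of [O]. *)
Lemma hyper_compact : compact [set: hyperspace].
Proof.
rewrite compact_ultra => F FU _.
pose L : set X := [set x | forall O, nbhs x O -> F [set C : hyperspace | C `&` O !=set0]].
have cL : closed L.
  move=> x Lx O; rewrite nbhsE => -[V [oV Vx] VO].
  have [y [Ly Vy]] := Lx V (open_nbhs_nbhs (conj oV Vx)).
  have := Ly V (open_nbhs_nbhs (conj oV Vy)).
  by apply: filterS => C [z [Cz Vz]]; exists z; split=> //; exact: VO.
exists (Hyperspace cL); split=> //; apply: vietoris_cvg => /= O oO.
  move=> LO.
  have cO : compact (~` O).
    by apply: subclosed_compact (@flow_compact G X) _ => //; exact: open_closedC.
  have := (compact_near_coveringP (~` O)).1 cO _ F
    (fun (C : hyperspace) x => ~ hyper_set C x) _.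
  have H x : (~` O) x -> \forall x' \near x & C \near F, ~ hyper_set C x'.
    move=> nOx; have : ~ L x by move=> /LO.
    move=> /existsNP[V /not_implyP[xV nFV]].
    exists (V, [set C : hyperspace | ~ (C `&` V !=set0)]) => /=.
      split=> //; have [//|] := in_ultra_setVsetC [set C : hyperspace | C `&` V !=set0] FU.
      by [].
    by move=> [y C] /= [Vy nCV] Cy; apply: nCV; exists y.
  move=> /(_ _ H); apply: filterS => C OC x Cx; apply: contrapT => nOx.
  exact: OC Cx.
by move=> [x [Lx Ox]]; apply: Lx; exact: open_nbhs_nbhs.
Qed.

Lemma hyper_hausdorff : hausdorff_space hyperspace.
Proof.
suff H (B C : hyperspace) : cluster (nbhs B) C -> B `<=` C.
  move=> B C BC; apply: hyperspaceP; split; first exact: H.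
  by apply: H => U V CU BV; rewrite setIC; exact: BC.
move=> BC x Bx; apply: contrapT => /hyper_near_miss[V xV CV].
have [D [[y [Dy Vy]] nD]] := BC _ _ (hyper_near_meet Bx xV) CV.
exact: nD Dy.
Qed.

(** The translate of [B] is written as a preimage under [g^-1], which makes it visibly closed. *)
Lemma hyper_act_closed (g : G) (B : hyperspace) : closed (act g^-1%g @^-1` B).
Proof.
by apply: preimage_closed; [move=> x _; exact: act_continuous|exact: hyper_closed].
Qed.

Definition hyper_act (g : G) (B : hyperspace) := Hyperspace (@hyper_act_closed g B).

Lemma hyper_actE g (B : hyperspace) x : hyper_set (hyper_act g B) (act g x) <-> hyper_set B x.
Proof. by rewrite /= /preimage/= actK. Qed.

Lemma hyper_continuous_action : continuous_action hyper_act.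
Proof.
split.
- by move=> B; apply: hyperspaceP; split=> x; rewrite /= /preimage/= invg1 act1.
- by move=> g h B; apply: hyperspaceP; split=> x; rewrite /= /preimage/= monoid.invgM actM.
move=> [g B]; apply: vietoris_cvg => O oO /=.
  move=> gBO.
  have cO : compact (~` O).
    by apply: subclosed_compact (@flow_compact G X) _ => //; exact: open_closedC.
  have := (compact_near_coveringP (~` O)).1 cO _ (nbhs (g, B))
    (fun (hC : G * hyperspace) x => ~ hyper_set hC.2 (act hC.1^-1%g x)) _.
  have H x : (~` O) x -> \forall x' \near x & hC \near (g, B),
      ~ hyper_set hC.2 (act hC.1^-1%g x').
    move=> nOx; have : ~ hyper_set B (act g^-1%g x) by move=> /gBO.
    move=> /hyper_near_miss[V xV BV].
    have cont : continuous (fun z : G * X => act z.1^-1%g z.2).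
      move=> z; apply: (@continuous_comp _ _ _ (fun z : G * X => (z.1^-1%g, z.2))
        (fun z : G * X => act z.1 z.2)); last exact: act_continuous2.
      apply: cvg_pair => /=; last exact: cvg_snd.
      by apply: continuous_comp; [exact: cvg_fst|exact: invg_continuous].
    have [[N W] /= [gN xW] NWV] := cont (g, x) V xV.
    exists (W, N `*` [set C : hyperspace | forall y, V y -> ~ hyper_set C y]) => /=.
      by split=> //; exists (N, [set C : hyperspace | forall y, V y -> ~ hyper_set C y]).
    by move=> [y [h C]] /= [Wy [Nh CV]]; apply: CV; exact: (NWV (h, y)).
  move=> /(_ _ H); apply: filterS => -[h C] /= OC x Cx; apply: contrapT => nOx.
  exact: OC Cx.
move=> [y [/= By Oy]].
have [[N V] /= [gN xV] NVO] : nbhs (g, act g^-1%g y) ((fun z : G * X => act z.1 z.2) @^-1` O).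
  by apply: act_continuous2; apply: open_nbhs_nbhs; split=> //=; rewrite actVK.
exists (N, [set C : hyperspace | C `&` V !=set0]) => /=.
  by split=> //; exact: hyper_near_meet xV.
move=> [h C] /= [Nh [z [Cz Vz]]]; exists (act h z).
by split; [exact/hyper_actE|exact: (NVO (h, z))].
Qed.

HB.instance Definition _ := isFlow.Build G hyperspace
  hyper_continuous_action hyper_compact hyper_hausdorff.

Lemma closed_hyper_mem : closed [set z : X * hyperspace | hyper_set z.2 z.1].
Proof.
move=> [x B] c; apply: contrapT => /= /hyper_near_miss[V xV BV].
pose N := [set C : hyperspace | forall y, V y -> ~ hyper_set C y].
have [|[y C] /= [Cy [Vy CV]]] := c (V `*` N); first by exists (V, N).
exact: CV Cy.
Qed.

Lemma closed_hyper_sub : closed [set z : hyperspace * hyperspace | z.1 `<=` z.2].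
Proof.
move=> [B C] c x /= Bx; apply: contrapT => /= /hyper_near_miss[V xV CV].
have BV := hyper_near_meet Bx xV.
pose N := [set D : hyperspace | hyper_set D `&` V !=set0].
pose N' := [set D : hyperspace | forall y, V y -> ~ hyper_set D y].
have [|[B' C'] /= [BC [[y [By Vy]] CV']]] := c (N `*` N'); first by exists (N, N').
by apply: (CV' y) => //; exact: BC.
Qed.

End Hyperspace.

Section ProductFlow.
Context {G : topologicalGroupType} (X Y : flowType G).

Definition product_act (g : G) (z : X * Y) := (act g z.1, act g z.2).

Lemma product_continuous_action : continuous_action product_act.
Proof.
split=> [[x y]|g h [x y]|].
- by rewrite /product_act !act1.
- by rewrite /product_act !actM.
apply: pair_continuous.
- move=> z; apply: (@continuous_comp _ _ _ (fun z : G * (X * Y) => (z.1, z.2.1))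
    (fun z : G * X => act z.1 z.2)); last exact: act_continuous2.
  apply: cvg_pair => /=; first exact: cvg_fst.
  exact: (comp_continuous (@snd_continuous _ _) (@fst_continuous _ _)).
- move=> z; apply: (@continuous_comp _ _ _ (fun z : G * (X * Y) => (z.1, z.2.2))
    (fun z : G * Y => act z.1 z.2)); last exact: act_continuous2.
  apply: cvg_pair => /=; first exact: cvg_fst.
  exact: (comp_continuous (@snd_continuous _ _) (@snd_continuous _ _)).
Qed.

HB.instance Definition _ := isFlow.Build G (X * Y)%type product_continuous_action
  (compactT_setX (@flow_compact G X) (@flow_compact G Y))
  (hausdorff_setX (@flow_hausdorff G X) (@flow_hausdorff G Y)).

Lemma gmap_fst : gmap (fst : (X * Y)%type -> X).
Proof. by split=> //; exact: fst_continuous. Qed.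

Lemma gmap_snd : gmap (snd : (X * Y)%type -> Y).
Proof. by split=> //; exact: snd_continuous. Qed.

End ProductFlow.

(** * Quotients of minimal flows *)

Section Quotient.
Context {G : topologicalGroupType} (W : minimalFlowType G) (e : W -> W -> Prop).

Definition classes : Type := {A : set W | exists x, A = e x}.

HB.instance Definition _ := gen_eqMixin classes.
HB.instance Definition _ := gen_choiceMixin classes.

Definition class_of (x : W) : classes := exist _ (e x) (ex_intro _ x erefl).

Definition classes_open : set_system classes := [set U | open (class_of @^-1` U)].

Let classes_openT : classes_open setT.
Proof. exact: openT. Qed.

Let classes_openI : setI_closed classes_open.
Proof. by move=> U V oU oV; exact: openI. Qed.

Let classes_open_bigU (I : Type) (f : I -> set classes) :
  (forall i, classes_open (f i)) -> classes_open (\bigcup_i f i).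
Proof.
move=> fo; rewrite /classes_open/= preimage_bigcup.
by apply: bigcup_open => i _; exact: fo.
Qed.

HB.instance Definition _ :=
  isOpenTopological.Build classes classes_openT classes_openI classes_open_bigU.

Hypotheses (er : forall x, e x x) (es : forall x y, e x y -> e y x)
  (et : forall x y z, e x y -> e y z -> e x z).
Hypothesis ec : closed [set z : W * W | e z.1 z.2].
Hypothesis eG : forall (g : G) x y, e x y -> e (act g x) (act g y).

Let class_ofP x y : class_of x = class_of y <-> e x y.
Proof.
split=> [/(congr1 (@proj1_sig _ _)) /= ->|exy]; first exact: er.
apply: eq_exist => /=; apply/funext => z; apply/propext; split=> [xz|yz].
- exact: et (es exy) xz.
- exact: et exy yz.
Qed.

Let class_of_surj c : exists x, class_of x = c.
Proof. by case: c => A [x Ax]; exists x; apply: eq_exist. Qed.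

Let class_of_continuous : continuous class_of.
Proof. by apply/continuousP. Qed.

(** The saturation of [C] is the second projection of the part of the closed relation lying over
    [C]. *)
Let class_of_closed C : closed C -> closed (class_of @` C).
Proof.
move=> cC.
suff : closed (class_of @^-1` (class_of @` C)).
  move=> cqC; rewrite -[X in closed X]setCK; apply: open_closedC.
  change (open (class_of @^-1` (~` (class_of @` C)))).
  by rewrite preimage_setC; exact: closed_openC.
have -> : class_of @^-1` (class_of @` C) =
    snd @` ([set z : W * W | e z.1 z.2] `&` fst @^-1` C).
  apply/seteqP; split=> [y [x Cx /class_ofP xy]|_ [[x y] [/= xy Cx] <-]].
    by exists (x, y).
  by exists x => //; apply/class_ofP.
apply: closed_image.
- by apply: compactT_setX; exact: flow_compact.
- exact: flow_hausdorff.
- exact: snd_continuous.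
- apply: closedI => //; apply: preimage_closed => // z _; exact: fst_continuous.
Qed.

Let classes_compact : compact [set: classes].
Proof.
have -> : [set: classes] = class_of @` [set: W].
  by apply/seteqP; split=> // c _; have [x <-] := class_of_surj c; exists x.
apply: continuous_compact; last exact: flow_compact.
exact: continuous_subspaceT.
Qed.

Let classes_hausdorff : hausdorff_space classes.
Proof.
apply: (closed_onto_hausdorff (@flow_compact G W) (@flow_hausdorff G W)
  class_of_continuous class_of_closed class_of_surj).
Qed.

Let repr c := projT1 (cid (class_of_surj c)).
Let reprK c : class_of (repr c) = c.
Proof. by rewrite /repr; case: cid. Qed.

Let classes_act (g : G) (c : classes) := class_of (act g (repr c)).
Let classes_actE g x : classes_act g (class_of x) = class_of (act g x).
Proof. by apply/class_ofP/eG/class_ofP; rewrite reprK. Qed.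

Let classes_continuous_action : continuous_action classes_act.
Proof.
split.
- by move=> c; have [x <-] := class_of_surj c; rewrite classes_actE act1.
- by move=> g h c; have [x <-] := class_of_surj c; rewrite !classes_actE actM.
move=> [g z] O /=; rewrite nbhsE => -[O' [oO' O'z] O'O].
have cW := (compact_near_coveringP [set: W]).1 (@flow_compact G W).
(* A tube argument over the compact [W]: near each [w], either its class is [z] and continuity of
   the action on [W] applies, or its class is separated from all [c] near [z] and the premise
   fails. *)
have := cW _ (nbhs (g, z)) (fun hc w => class_of w = hc.2 -> O (class_of (act hc.1 w))) _.
have H w : [set: W] w -> \forall w' \near w & hc \near (g, z),
    class_of w' = hc.2 -> O (class_of (act hc.1 w')).
  move=> _; have [wz|nwz] := pselect (class_of w = z).
    have [|[N V] /= [gN wV] NVO] := @act_continuous2 G W (g, w) (class_of @^-1` O').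
      apply: open_nbhs_nbhs; split; first exact: open_comp.
      by rewrite /preimage/= -classes_actE wz.
    exists (V, N `*` setT) => /=.
      by split=> //; exists (N, setT) => //; split=> //; exact: filterT.
    by move=> [w' [h c]] /= [Vw' [Nh _]] _; apply/O'O; exact: (NVO (h, w')).
  have := classes_hausdorff; rewrite open_hausdorff.
  move=> /(_ (class_of w) z); move: nwz => /eqP nwz /(_ nwz).
  move=> [[U V] /= [/set_mem Uw /set_mem Vz] [oU oV /eqP UV]].
  exists (class_of @^-1` U, setT `*` V) => /=.
    split; first by apply: class_of_continuous; exact: open_nbhs_nbhs.
    by exists (setT, V) => //=; split; [exact: filterT|exact: open_nbhs_nbhs].
  move=> [w' [h c]] /= [Uw' [_ Vc]] w'c.
  have : (U `&` V) c by split=> //; rewrite -w'c.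
  by rewrite UV.
move=> /(_ _ H); apply: filterS => -[h c] /= Hc; apply: Hc => //; exact: reprK.
Qed.

Lemma exists_quotient : exists (Z : minimalFlowType G) (q : W -> Z),
  [/\ gmap q, forall z, exists x, q x = z & forall x y, q x = q y <-> e x y].
Proof.
pose Z0 : flowType G := HB.pack classes
  (isFlow.Build G classes classes_continuous_action classes_compact classes_hausdorff).
have gq : @gmap G W Z0 class_of by split=> // g x; exact/esym/classes_actE.
have mZ : minimal Z0.
  have [[x _] dW] := @minimalP G W; split; first by exists (class_of x).
  move=> z; have [w wz] := class_of_surj z; subst z => O [c Oc] oO.
  have [y yc] := class_of_surj c.
  have [||w' [Ow [g _ gw]]] := dW w (class_of @^-1` O).
  - by exists y; rewrite /preimage/= yc.
  - exact: open_comp.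
  by exists (class_of w'); split=> //; exists g => //; rewrite -gw gq.2.
pose Z : minimalFlowType G := HB.pack (Flow.sort Z0) (Flow_isMinimal.Build _ _ mZ).
by exists Z, class_of.
Qed.

End Quotient.

Lemma exists_factor (G : topologicalGroupType) (W X : flowType G)
    (Z : flowType G) (q : W -> Z) (f : W -> X) :
  gmap q -> (forall z, exists x, q x = z) -> gmap f ->
  (forall x y, q x = q y -> f x = f y) ->
  exists2 h : Z -> X, gmap h & forall x, h (q x) = f x.
Proof.
move=> gq sq gf qf.
pose h z := f (projT1 (cid (sq z))).
have hE x : h (q x) = f x by rewrite /h; case: cid => y /= /qf.
exists h => //; split; last first.
  by move=> g z; have [x <-] := sq z; rewrite -gq.2 !hE gf.2.
apply/continuous_closedP => C cC.
have -> : h @^-1` C = q @` (f @^-1` C).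
  apply/seteqP; split=> [z|_ [x Cx <-]]; last by rewrite /preimage/= hE.
  by have [x <-] := sq z; rewrite /preimage/= hE => Cx; exists x.
apply: closed_image => //; [exact: flow_compact|exact: flow_hausdorff|exact: gq.1|].
by apply: preimage_closed => // x _; exact: gf.1.
Qed.

(** * Extensions with Hausdorff Ellis group *)

Section Envelope.
Context {G : topologicalGroupType} (M : minimalFlowType G).

(* b is the least G-map from J to the hyperspace of M such that b j contains
   the Aut(M)-orbit of a j; minimality makes it invariant under Aut(J). *)
Lemma exists_orbit_hull : minimal_ideal_flow M ->
  exists (J : minimalFlowType G) (a : J -> M) (b : J -> hyperspace M),
    [/\ minimal_ideal_flow J, gmap a, gmap b,
        forall (q : flow_aut J) j, b (q j) = b j &
        forall j j', b j = b j' -> graphs_closure setT (a j, a j')].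
Proof.
move=> mM; pose P : flowType G := (M * hyperspace M)%type.
have [J /ideal_flow_action[e ea]] := exists_ideal_flow P.
have mJ := ideal_action_minimal_ideal ea.
have [u uu _] := ideal_idempotent ea (point_of J).
have [F FF [Fe Fm]] := ideal_limit ea u.
have {Fm} Fu : act g u @[g --> F] --> u by rewrite -{2}uu; exact: Fm.
have [egmap _ _ _] := ea.
(* Only the first coordinate is kept in [a]; the full set is a filler. *)
have closedTM : closed [set: M] by [].
pose a j := (e j (point_of M, Hyperspace closedTM)).1.
have ga : gmap a by exact: (gmap_comp (@gmap_fst G M (hyperspace M)) (egmap _)).
pose A := closure (range (fun p : flow_aut M => p (a u))).
have cA : closed A by exact: closed_closure.
(* Along [F] the translates of [a u] return to [a u] and those of [A] tend to [b u], so facts about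
   [a u] and [A] pass to [b u] in the limit. *)
pose b j := (e j (a u, Hyperspace cA)).2.
have gb : gmap b by exact: (gmap_comp (@gmap_snd G M (hyperspace M)) (egmap _)).
have Fau : act g (a u) @[g --> F] --> a u by exact: gmap_cvg.
have FA : act g (Hyperspace cA) @[g --> F] --> b u.
  exact: (@gmap_cvg G P (hyperspace M) snd F (a u, Hyperspace cA) _ _
    (@gmap_snd G M (hyperspace M)) (Fe (a u, Hyperspace cA))).
have pA (p : flow_aut M) : A (p (a u)) by apply: subset_closure; exists p.
have orbit_b (p : flow_aut M) j : hyper_set (b j) (p (a j)).
  move: j; apply: (@closed_invariant_full _ _ [set j | hyper_set (b j) (p (a j))]).
  - apply: (@preimage_closed _ _ (fun j => (p (a j), b j))
      [set z : M * hyperspace M | hyper_set z.2 z.1]); last exact: closed_hyper_mem.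
    move=> j _; apply: pair_continuous; last exact: gb.1.
    exact: comp_continuous ga.1 (aut_gmap p).1.
  - move=> g j /=; rewrite ga.2 gb.2 (aut_gmap p).2.
    by move=> ?; apply/hyper_actE.
  - exists u; apply: (closed_cvg2 FF (@closed_hyper_mem _ M) _
      (gmap_cvg FF (aut_gmap p) Fau) FA).
    by move=> g; apply/hyper_actE; exact: pA.
have least (b' : J -> hyperspace M) : gmap b' ->
    (forall (p : flow_aut M) j, hyper_set (b' j) (p (a j))) ->
    forall j, hyper_set (b j) `<=` hyper_set (b' j).
  move=> gb' orbit_b'.
  apply: (@closed_invariant_full _ _ [set j | hyper_set (b j) `<=` hyper_set (b' j)]).
  - apply: (@preimage_closed _ _ (fun j => (b j, b' j))
      [set z : hyperspace M * hyperspace M | hyper_set z.1 `<=` hyper_set z.2]);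
      last exact: closed_hyper_sub.
    by move=> j _; apply: pair_continuous; [exact: gb.1|exact: gb'.1].
  - move=> g j /= bb'; rewrite gb.2 gb'.2 => x; exact: bb'.
  - exists u; apply: (closed_cvg2 FF (@closed_hyper_sub _ M) _ FA
      (gmap_cvg FF gb' Fu)).
    move=> g x; suff Ab' : A `<=` hyper_set (b' u) by exact: Ab'.
    apply: subset_trans (@hyper_closed _ _ (b' u)); apply: closureS.
    by move=> _ [p _ <-].
exists J, a, b; split=> //.
  (* [b \o q] satisfies the same orbit condition, since [a \o q] is [a] followed by an automorphism
     of [M]. Leastness gives one inclusion, the inverse of [q] the other. *)
  have sub (q : flow_aut J) j : hyper_set (b j) `<=` hyper_set (b (q j)).
    apply: (least (b \o q)); first exact: gmap_comp gb (aut_gmap q).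
    move=> p j' /=.
    have [p' p'E] := aut_through_factor mM ga (gmap_comp ga (aut_gmap q)).
    have := orbit_b (flow_autM p (flow_autV p')) (q j').
    by rewrite /= [a (q j')]p'E /= aut_funK.
  move=> q j; apply: hyperspaceP; split; last exact: sub.
  by have := sub (flow_autV q) (q j); rewrite /= aut_funK.
(* Each point of [b j] is a limit of points [p x] with [x] tending to [a j]; the orbit condition for
   the identity puts [a j'] into [b j']. *)
suff H j y : hyper_set (b j) y -> graphs_closure setT (a j, y).
  move=> j j' jj'; apply: H; rewrite jj'.
  exact: (orbit_b (flow_aut1 M) j').
move: j y; apply: (@closed_invariant_full _ _
  [set j | forall y, hyper_set (b j) y -> graphs_closure setT (a j, y)]).
- move=> j cj y bjy; apply: closure_pair => V W ajV yW.
  have [|j' [/= Hj' [aV [z [bz Wz]]]]] := cj (a @^-1` V° `&`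
      b @^-1` [set C : hyperspace M | hyper_set C `&` W° !=set0]).
    apply: filterI; first by apply: ga.1; exact: nbhs_interior.
    by apply: gb.1; apply: hyper_near_meet bjy _; exact: nbhs_interior.
  have [|[x1 x2] [x12 [/= Vx Wx]]] := Hj' _ bz (V `*` W).
    by exists (V, W) => //; split.
  by exists (x1, x2).
- move=> g j /= Hj y; rewrite gb.2 ga.2 => /Hj /(@graphs_closure_act _ _ _ g).
  by rewrite actVK.
- exists u => y bux; apply: closure_pair => V W auV yW.
  have FV : F [set g | V (act g (a u))] by exact: Fau.
  have FW : F [set g | hyper_set (act g (Hyperspace cA)) `&` W° !=set0].
    exact: (FA _ (hyper_near_meet bux (nbhs_interior yW))).
  have [g [/= Vg [z [Az Wz]]]] := filter_ex (filterI FV FW).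
  have [|_ [[p _ <-] Wp]] := Az (act g @^-1` W).
    by apply: act_continuous; rewrite actVK.
  exists (act g (a u), p (act g (a u))); split=> //.
    by exists p => //; exists (act g (a u)).
  by rewrite /= (aut_gmap p).2.
Qed.

End Envelope.

Lemma proximal_act (G : topologicalGroupType) (X : flowType G) (g : G) (x y : X) :
  proximal_pair x y -> proximal_pair (act g x) (act g y).
Proof.
move=> [F FF [z [xz yz]]].
exists ((fun h => (h * g^-1)%g) @ F); first exact: fmap_proper_filter.
have E (w : X) : (fun h : G => act (h * g^-1)%g (act g w)) = (fun h => act h w).
  by apply/funext => h; rewrite -actM -mulgA mulVg mulg1.
exists z; split.
- by move: xz; rewrite -E.
- by move: yz; rewrite -E.
Qed.

(** * The cocycle of a Hausdorff automorphism group *)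

Section HausdorffCocycle.
Context {G : topologicalGroupType} (M : minimalFlowType G).
Hypothesis mM : minimal_ideal_flow M.
Hypothesis hG : hausdorff_space (ellis_group M).

Definition cocycle (x y : M) (p : ellis_group M) :=
  graphs_closure setT (x, y) /\ proximal_pair (p x) y.

Lemma graphs_closureU (A B : set (ellis_group M)) :
  graphs_closure (A `|` B) = graphs_closure A `|` graphs_closure B.
Proof. by rewrite /graphs_closure bigcup_setU closureU. Qed.

(** Otherwise [(x, y)] would lie in the closure of the graphs from the closed complement of [U],
    which would then contain [p]. *)
Lemma cocycle_graphs_closure x y p U : open U -> U p -> cocycle x y p ->
  graphs_closure U (x, y).
Proof.
move=> oU Up [xy pxy]; move: xy; rewrite -(setUv U) graphs_closureU => -[//|nU].
have := proximal_graphs_closure nU pxy.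
by have /closure_id <- := open_closedC oU.
Qed.

Lemma cocycle_unique x y p q : cocycle x y p -> cocycle x y q -> p = q.
Proof.
move=> xyp [_ qxy]; apply: hG => U V; rewrite nbhsE => -[U' [oU Up] UU'] qV.
have := proximal_graphs_closure (cocycle_graphs_closure oU Up xyp) qxy.
by move=> /(_ _ qV)[r [/UU' Ur Vr]]; exists r.
Qed.

Lemma cocycle_exists x y : graphs_closure setT (x, y) -> exists p, cocycle x y p.
Proof. by move=> xy; have [p] := mM x y; exists p. Qed.

Lemma cocycle_act (g : G) x y p : cocycle x y p -> cocycle (act g x) (act g y) p.
Proof.
move=> [xy pxy]; split; first exact: graphs_closure_act.
by rewrite (aut_gmap p).2; exact: proximal_act.
Qed.

(** At a limit point, [(x, y)] lies in the closure of the graphs from every neighborhood of [p]. The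
    value [q] of the cocycle at [(x, y)] is therefore in the closure of each neighborhood, so
    [q = p]. *)
Lemma closed_cocycle :
  closed [set z : (M * M) * ellis_group M | cocycle z.1.1 z.1.2 z.2].
Proof.
move=> [[x y] p] c /=.
have gU U : nbhs p U -> graphs_closure U (x, y).
  rewrite nbhsE => -[U' [oU' U'p] U'U].
  have : graphs_closure U' (x, y).
    apply: (@closed_closure _ (\bigcup_(q in U') graph q)) => N xyN.
    have [|[[x' y'] p'] [/= xyp' [/= Nxy' Up']]] := c (N `*` U').
      by exists (N, U') => //; split=> //; exact: open_nbhs_nbhs.
    by exists (x', y'); split=> //; exact: cocycle_graphs_closure xyp'.
  by apply: closureS; exact: bigcup_subset.
have [q xyq] := cocycle_exists (gU _ filterT).
suff <- : q = p by [].
apply: hG => V U qV pU.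
have [r [Ur Vr]] := proximal_graphs_closure (gU U pU) xyq.2 qV.
by exists r.
Qed.

End HausdorffCocycle.

(** * Quotients of the hull by the cocycle *)

Section HausdorffExtension.
Context {G : topologicalGroupType} (X M : minimalFlowType G) (phi : M -> X).
Hypotheses (mM : minimal_ideal_flow M) (gphi : gmap phi).
Hypothesis hM : hausdorff_space (ellis_group M).

Let stab : set (ellis_group M) := [set p | forall x, phi (p x) = phi x].

Let closed_stab : closed stab.
Proof.
rewrite closure_id; apply/seteqP; split; first exact: subset_closure.
rewrite closure_tauE => p pS x.
have cD : closed [set z : M * M | phi z.2 = phi z.1].
  apply: closed_eq; first exact: flow_hausdorff.
  - exact: comp_continuous (@snd_continuous _ _) gphi.1.
  - exact: comp_continuous (@fst_continuous _ _) gphi.1.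
suff H : closure (\bigcup_(q in stab) graph q) `<=` [set z | phi z.2 = phi z.1].
  by apply: (H (x, p x)); apply: pS; exists x.
by apply: subset_trans cD; apply: closureS => _ [q Sq [y _ <-]]; exact: Sq.
Qed.

Variables (J : minimalFlowType G) (a : J -> M) (b : J -> hyperspace M).
Hypotheses (mJ : minimal_ideal_flow J) (ga : gmap a) (gb : gmap b).
Hypothesis b_aut : forall (q : flow_aut J) j, b (q j) = b j.
Hypothesis b_eq : forall j j', b j = b j' -> graphs_closure setT (a j, a j').

(** Restricting to the fibers of [b] makes the domain of the cocycle an equivalence relation. *)
Let hull_rel (j j' : J) (p : ellis_group M) := b j = b j' /\ cocycle (a j) (a j') p.

Let hull_rel1 j : hull_rel j j 1%g.
Proof. by split=> //; split; [exact: b_eq|exact: proximal_refl]. Qed.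

Let hull_relV j j' p : hull_rel j j' p -> hull_rel j' j p^-1%g.
Proof.
move=> [bjj' [_ pjj']]; split=> //; split; first exact: b_eq.
apply: proximal_sym; rewrite -{1}(aut_funK p (a j)).
exact: (proximal_gmap (aut_inv_gmap p) pjj').
Qed.

Let hull_rel_act (g : G) j j' p : hull_rel j j' p -> hull_rel (act g j) (act g j') p.
Proof.
by move=> [bjj' c]; split; [rewrite !gb.2 bjj'|rewrite !ga.2; exact: cocycle_act].
Qed.

Let hull_rel_unique j j' p q : hull_rel j j' p -> hull_rel j j' q -> p = q.
Proof. by move=> [_ pj] [_ qj]; exact: (cocycle_unique hM pj qj). Qed.

Let hull_rel_exists j j' : b j = b j' -> exists p, hull_rel j j' p.
Proof.
by move=> bjj'; have [p pj] := cocycle_exists mM (b_eq bjj'); exists p.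
Qed.

Let closed_hull_rel : closed [set z : (J * J) * ellis_group M | hull_rel z.1.1 z.1.2 z.2].
Proof.
have c1 : continuous (fun z : (J * J) * ellis_group M => z.1.1).
  exact: comp_continuous (@fst_continuous _ _) (@fst_continuous _ _).
have c2 : continuous (fun z : (J * J) * ellis_group M => z.1.2).
  exact: comp_continuous (@fst_continuous _ _) (@snd_continuous _ _).
apply: closedI.
  apply: closed_eq; first exact: flow_hausdorff.
  - exact: comp_continuous c1 gb.1.
  - exact: comp_continuous c2 gb.1.
apply: (@preimage_closed _ _ (fun z : (J * J) * ellis_group M => ((a z.1.1, a z.1.2), z.2)))
  (closed_cocycle mM hM).
move=> z _; apply: pair_continuous; last exact: snd_continuous.
apply: pair_continuous.
- exact: comp_continuous c1 ga.1.
- exact: comp_continuous c2 ga.1.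
Qed.

(* The limit of (j, j', j'') along a net making (p (a j), a j') proximal has
   a k' = p (a k), where the cocycle identity is immediate. *)
Let hull_relM j j' j'' p q :
  hull_rel j j' p -> hull_rel j' j'' q -> hull_rel j j'' (q * p)%g.
Proof.
move=> jp jq.
have [r jr] : exists r, hull_rel j j'' r.
  by apply: hull_rel_exists; rewrite jp.1 jq.1.
have [F FU [z [pz az]]] := proximal_ultra jp.2.2.
have FF : ProperFilter F by exact: ultra_proper.
have [k jk] := flow_ultra_cvg (fun g : G => act g j) FU.
have [k' jk'] := flow_ultra_cvg (fun g : G => act g j') FU.
have [k'' jk''] := flow_ultra_cvg (fun g : G => act g j'') FU.
have lim i i' s l l' : hull_rel i i' s -> act g i @[g --> F] --> l ->
    act g i' @[g --> F] --> l' -> hull_rel l l' s.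
  move=> ii' il il'.
  apply: (closed_cvg2 FF closed_hull_rel (u := fun g => (act g i, act g i'))
    (v := fun=> s) (t := (l, l'))); last exact: cvg_cst.
  - by move=> g; exact: hull_rel_act.
  - exact: cvg_pair.
have kr := lim _ _ _ _ _ jr jk jk''.
have kq := lim _ _ _ _ _ jq jk' jk''.
have ak' : a k' = p (a k).
  rewrite -(flow_cvg_unique FF az (gmap_cvg FF ga jk')).
  exact: (flow_cvg_unique FF pz (gmap_cvg FF (gmap_comp (aut_gmap p) ga) jk)).
suff -> : (q * p)%g = r by [].
apply: (hull_rel_unique _ kr); split; first exact: kr.1.
split; first exact: b_eq kr.1.
by have := kq.2.2; rewrite ak'.
Qed.

Let coset_rel j j' := exists2 p, hull_rel j j' p & stab p.

Let coset_rel_refl j : coset_rel j j.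
Proof. by exists 1%g. Qed.

Let coset_rel_sym j j' : coset_rel j j' -> coset_rel j' j.
Proof.
move=> [p jp Sp]; exists (p^-1)%g; first exact: hull_relV.
by move=> x; rewrite -[x in RHS](aut_invK p) Sp.
Qed.

Let coset_rel_trans j j' j'' : coset_rel j j' -> coset_rel j' j'' -> coset_rel j j''.
Proof.
move=> [p jp Sp] [q jq Sq]; exists (q * p)%g; first exact: hull_relM jp jq.
by move=> x; rewrite -(Sp x) -[RHS](Sq (p x)).
Qed.

Let coset_rel_act (g : G) j j' : coset_rel j j' -> coset_rel (act g j) (act g j').
Proof. by move=> [p jp Sp]; exists p => //; exact: hull_rel_act. Qed.

Let compactJJ : compact [set: (J * J) * ellis_group M].
Proof.
apply: compactT_setX; last exact: tau_compact.
by apply: compactT_setX; exact: flow_compact.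
Qed.

Let hausdorffJJ : hausdorff_space (J * J)%type.
Proof. by apply: hausdorff_setX; exact: flow_hausdorff. Qed.

Let closed_hull_rel_in (S : set (ellis_group M)) : closed S ->
  closed [set z : J * J | exists2 p, hull_rel z.1 z.2 p & S p].
Proof.
move=> cS.
have -> : [set z : J * J | exists2 p, hull_rel z.1 z.2 p & S p] =
    fst @` ([set z : (J * J) * ellis_group M | hull_rel z.1.1 z.1.2 z.2] `&` snd @^-1` S).
  apply/seteqP; split=> [z [p zp Sp]|_ [[z p] [zp Sp] <-]]; last by exists p.
  by exists (z, p).
apply: closed_image => //; first exact: fst_continuous.
by apply: closedI => //; apply: preimage_closed => // z _; exact: snd_continuous.
Qed.

Let closed_hull_rel_of (D : set (J * J)) : closed D ->
  closed [set p | exists2 z, hull_rel z.1 z.2 p & D z].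
Proof.
move=> cD.
have -> : [set p | exists2 z, hull_rel z.1 z.2 p & D z] =
    snd @` ([set z : (J * J) * ellis_group M | hull_rel z.1.1 z.1.2 z.2] `&` fst @^-1` D).
  apply/seteqP; split=> [p [z zp Dz]|_ [[z p] [zp Dz] <-]]; last by exists z.
  by exists (z, p).
apply: closed_image => //; first exact: snd_continuous.
by apply: closedI => //; apply: preimage_closed => // z _; exact: fst_continuous.
Qed.

(** The value [p] of a pair is constant along its orbit. [S] collects the values of pairs outside
    the interior of [B], and [A] excludes the pairs with value in [S]. No element of [stab] is in
    [S], as pairs with such a value collapse in [Z]; hence [A] surrounds the diagonal. *)
Let equicontinuous (Z : minimalFlowType G) (q : J -> Z) (T : Type) (sigma : Z -> T) :
  gmap q -> (forall z, exists j, q j = z) ->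
  (forall j j', q j = q j' <-> coset_rel j j') ->
  (forall j j', sigma (q j) = sigma (q j') -> b j = b j') ->
  equicontinuous_map sigma.
Proof.
move=> gq sq qE sE B eB.
have nB : diagonal_nbhs B := eB.
pose qq := fun z : J * J => (q z.1, q z.2).
have cqq : continuous qq.
  apply: pair_continuous.
  - exact: comp_continuous (@fst_continuous _ _) gq.1.
  - exact: comp_continuous (@snd_continuous _ _) gq.1.
pose S := [set p | exists2 z, hull_rel z.1 z.2 p & (~` (qq @^-1` B°)) z].
have cS : closed S.
  apply: closed_hull_rel_of; apply: open_closedC; apply: open_comp => //.
  exact: open_interior.
pose A := ~` (qq @` [set z | exists2 p, hull_rel z.1 z.2 p & S p]).
exists A.
  suff : diagonal_nbhs A by [].
  move=> z; apply: open_nbhs_nbhs; split.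
    apply: closed_openC; apply: closed_image => //.
    - by apply: compactT_setX; exact: flow_compact.
    - by apply: hausdorff_setX; exact: flow_hausdorff.
    - exact: closed_hull_rel_in.
  move=> [[j j'] /= [p jp [[i i'] /= ip nBi]] [qj qj']].
  have [p' jp' Sp'] : coset_rel j j' by apply/qE; rewrite qj.
  have pp' := hull_rel_unique jp jp'; subst p'.
  have qi : q i = q i' by apply/qE; exists p.
  by apply: nBi; rewrite /preimage/= /qq/= qi; exact: nB.
move=> z0 z1; have [j <-] := sq z0; have [j' <-] := sq z1.
move=> Ajj' /sE bjj' g; apply: contrapT => nBg; apply: Ajj'.
have [p jp] := hull_rel_exists bjj'.
exists (j, j') => //; exists p => //; exists (act g j, act g j').
  exact: hull_rel_act.
by move=> /= /interior_subset; rewrite /qq/= !gq.2.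
Qed.

(** The cocycle from [j] to [s j] is the automorphism of [M] that [s] induces through [a]. *)
Let aut_hull_rel (s : flow_aut J) :
  exists p : ellis_group M, forall j, a (s j) = p (a j) /\ hull_rel j (s j) p.
Proof.
have [p pE] := aut_through_factor mM ga (gmap_comp ga (aut_gmap s)).
exists p => j; split; first exact: pE.
split; first by rewrite b_aut.
split; first by apply: b_eq; rewrite b_aut.
by rewrite [a (s j)]pE; exact: proximal_refl.
Qed.

Lemma hull_extension : exists (Xs Y Z : minimalFlowType G)
    (eta : Xs -> X) (iota : Xs -> Z) (sigma : Z -> Y),
  [/\ gmap eta, gmap iota & gmap sigma] /\
  [/\ proximal_flow Y, proximal_map eta, proximal_map iota &
      equicontinuous_map sigma].
Proof.
have cc (T : topologicalType) (f : J -> T) : hausdorff_space T -> continuous f ->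
    closed [set z : J * J | f z.1 = f z.2].
  move=> hT cf; apply: closed_eq => //.
  - exact: comp_continuous (@fst_continuous _ _) cf.
  - exact: comp_continuous (@snd_continuous _ _) cf.
have closed_coset : closed [set z : J * J | coset_rel z.1 z.2].
  exact: closed_hull_rel_in closed_stab.
have gpa := gmap_comp gphi ga.
have [||||| Y [r [gr sr rE]]] := @exists_quotient G J (fun j j' => b j = b j').
- by [].
- by [].
- by move=> j j' j'' ->.
- exact: cc (@flow_hausdorff G (hyperspace M)) gb.1.
- by move=> g j j' bb; rewrite !gb.2 bb.
have [Z [q [gq sq qE]]] := @exists_quotient G J coset_rel coset_rel_refl coset_rel_sym
  coset_rel_trans closed_coset coset_rel_act.
(* [Xs] is, up to isomorphism, the image of [J] in the product of [Z] and [X]. *)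
have [||||| Xs [t [gt st tE]]] := @exists_quotient G J
  (fun j j' => coset_rel j j' /\ phi (a j) = phi (a j')).
- by [].
- by move=> j j' [? ->]; split=> //; exact: coset_rel_sym.
- by move=> j j' j'' [jj' ->] [j'j'' ->]; split=> //; exact: coset_rel_trans jj' j'j''.
- by apply: closedI => //; exact: cc (@flow_hausdorff G X) gpa.1.
- move=> g j j' [jj' pp]; split; first exact: coset_rel_act.
  by rewrite !ga.2 !gphi.2 pp.
have [||||eta geta etaE] := @exists_factor G J X Xs t (phi \o a); [by []|by []|by []| |].
  by move=> j j' /tE[].
have [||||iota giota iotaE] := @exists_factor G J Z Xs t q; [by []|by []|by []| |].
  by move=> j j' /tE[jj' _]; apply/qE.
have [||||sigma gsigma sigmaE] := @exists_factor G J Y Z q r; [by []|by []|by []| |].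
  by move=> j j' /qE[p [bb _] _]; apply/rE.
exists Xs, Y, Z, eta, iota, sigma; split; first by split.
split.
(* All three proximality claims replace [j] by some [s j] proximal to [j'] and show that [s j] and
   [j] have the same image. *)
- move=> y y' _; have [j <-] := sr y; have [j' <-] := sr y'.
  have [s sj] := mJ j j'.
  have <- : r (s j) = r j by apply/rE; exact: b_aut.
  exact: proximal_gmap.
- move=> x x'; have [j <-] := st x; have [j' <-] := st x'; rewrite !etaE /= => ejj'.
  have [s sj] := mJ j j'; have [p pE] := aut_hull_rel s.
  have eq : phi \o a \o s =1 phi \o a.
    apply: (@gmap_proximal_eq _ _ _ _ _ j) => //.
      exact: gmap_comp gpa (aut_gmap s).
    by rewrite /= ejj'; exact: (proximal_gmap gpa sj).
  have Sp : stab p.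
    move=> x0; have [i <-] := gmap_surj j ga x0.
    by rewrite -(pE i).1; exact: eq.
  have <- : t (s j) = t j.
    apply/esym/tE; split; last exact/esym/eq.
    by exists p => //; exact: (pE j).2.
  exact: proximal_gmap.
- move=> x x'; have [j <-] := st x; have [j' <-] := st x'; rewrite !iotaE.
  move=> /qE[p' jp' Sp'].
  have [s sj] := mJ j j'; have [p pE] := aut_hull_rel s.
  have jp : hull_rel j j' p.
    split; first exact: jp'.1.
    split; first exact: b_eq jp'.1.
    by rewrite -(pE j).1; exact: proximal_gmap.
  have pp' := hull_rel_unique jp jp'; subst p'.
  have <- : t (s j) = t j.
    apply/esym/tE; split; last by rewrite (pE j).1 Sp'.
    by exists p => //; exact: (pE j).2.
  exact: proximal_gmap.
- apply: (equicontinuous gq sq qE) => j j'.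
  by rewrite !sigmaE => /rE.
Qed.

End HausdorffExtension.

Lemma hausdorff_structure (G : topologicalGroupType) (X M : minimalFlowType G)
    (phi : M -> X) : minimal_ideal_flow M -> gmap phi ->
  hausdorff_space (ellis_group M) ->
  exists (Xs Y Z : minimalFlowType G)
      (eta : Xs -> X) (iota : Xs -> Z) (sigma : Z -> Y),
    [/\ gmap eta, gmap iota & gmap sigma] /\
    [/\ proximal_flow Y, proximal_map eta, proximal_map iota &
        equicontinuous_map sigma].
Proof.
move=> mM gphi hM; have [J [a [b [mJ ga gb b_aut b_eq]]]] := exists_orbit_hull mM.
exact: (hull_extension mM gphi hM mJ ga gb b_aut b_eq).
Qed.

(** * Compact group extensions *)

(* The phantom z0 selects the topology: pointwise convergence at z0 only. *)
Definition fiber_group (G : topologicalGroupType) (Z : minimalFlowType G) (z0 : Z) :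
  Type := flow_aut Z.

Section FiberGroup.
Context {G : topologicalGroupType} (Z : minimalFlowType G) (z0 : Z).
Local Notation fiber_group := (fiber_group z0).

Definition fiber_eval (k : flow_aut Z) : Z := k z0.
HB.instance Definition _ := Topological.copy fiber_group (initial_topology fiber_eval).
HB.instance Definition _ := Group.copy fiber_group (flow_aut Z).

Definition fiber_act (k : fiber_group) (z : Z) : Z := aut_fun k z.

Lemma fiber_eval_continuous : continuous (fiber_eval : fiber_group -> Z).
Proof. exact: (@initial_continuous (flow_aut Z) Z fiber_eval). Qed.

Lemma fiber_group_hausdorff : hausdorff_space fiber_group.
Proof.
move=> p q pq; apply: (@aut_eq _ _ _ _ z0); apply: (@flow_hausdorff G Z) => A B pA qB.
have [y [Ay By]] := pq _ _ (fiber_eval_continuous pA) (fiber_eval_continuous qB).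
by exists (fiber_eval y).
Qed.

(** An ultrafilter converges at [z0]; closedness of the range provides an automorphism with that
    value, and the topology sees only [z0]. *)
Lemma fiber_group_compact : closed (range fiber_eval) -> compact [set: fiber_group].
Proof.
move=> cr; rewrite compact_ultra => F FU _.
have [l Fl] := flow_ultra_cvg fiber_eval FU.
have [k _ kl] : range fiber_eval l.
  by apply: (@closed_cvg _ _ F _ fiber_eval _ cr _ l) => //; apply: nearW => k; exists k.
exists k; split=> // U [_ [[O oO <-] /= Ok] OU].
rewrite nbhs_filterE; apply: filterS OU _; apply: Fl; rewrite -kl.
exact: open_nbhs_nbhs.
Qed.

Hypothesis cr : closed (range fiber_eval).
Hypothesis ca : continuous (fun kz : fiber_group * Z => fiber_act kz.1 kz.2).

Let fiber_mul_continuous :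
  continuous (fun kl : fiber_group * fiber_group => (kl.1 * kl.2)%g).
Proof.
apply: (@continuous_comp_initial _ _ _ fiber_eval).
apply: (comp_continuous
  (f := fun kl : fiber_group * fiber_group => (kl.1, fiber_eval kl.2)) _ ca).
apply: pair_continuous; first exact: fst_continuous.
exact: comp_continuous (@snd_continuous _ _) fiber_eval_continuous.
Qed.

(** The graph of the inverse action is that of the action with its two points of [Z] exchanged, so
    it is closed. *)
Let fiber_inv_continuous : continuous (fun k : fiber_group => (k^-1)%g).
Proof.
apply: (@continuous_comp_initial _ _ _ fiber_eval).
have ci : continuous (fun kz : fiber_group * Z => fiber_act (kz.1^-1)%g kz.2).
  apply: closed_graph_continuous.
  - by apply: compactT_setX; [exact: fiber_group_compact|exact: flow_compact].
  - by apply: hausdorff_setX; [exact: fiber_group_hausdorff|exact: flow_hausdorff].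
  - exact: flow_compact.
  have -> : [set z : fiber_group * Z * Z | z.2 = fiber_act (z.1.1^-1)%g z.1.2] =
      [set z | fiber_act z.1.1 z.2 = z.1.2].
    apply/seteqP; split=> [[[k z] w] /= -> |[[k z] w] /= <-].
      exact: (aut_invK k).
    by apply/esym; exact: (aut_funK k).
  apply: closed_eq; first exact: flow_hausdorff.
  - apply: (comp_continuous (f := fun z : fiber_group * Z * Z => (z.1.1, z.2)) _ ca).
    apply: pair_continuous; last exact: snd_continuous.
    exact: comp_continuous (@fst_continuous _ _) (@fst_continuous _ _).
  - exact: comp_continuous (@fst_continuous _ _) (@snd_continuous _ _).
apply: (comp_continuous (f := fun k : fiber_group => (k, z0)) _ ci).
by apply: pair_continuous; [move=> k; exact: cvg_id|exact: cst_continuous].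
Qed.

Lemma fiber_group_extension (T : Type) (sigma : Z -> T) :
  (forall z z', sigma z = sigma z' <-> exists k : flow_aut Z, k z = z') ->
  compact_group_extension sigma.
Proof.
move=> sE.
pose K : topologicalGroupType := HB.pack fiber_group
  (PreTopologicalGroup_isTopologicalGroup.Build fiber_group
    fiber_mul_continuous fiber_inv_continuous).
exists K, fiber_act; split.
- by split; [exact: fiber_group_compact|exact: fiber_group_hausdorff].
- by split.
- by move=> k; exists k.
- exact: sE.
Qed.

End FiberGroup.

(** Supplies the entourage fed to equicontinuity when two points are to be proved equal. Regularity
    shrinks one neighborhood so that the complement of the rectangle surrounds the whole
    diagonal. *)
Lemma separating_entourage (G : topologicalGroupType) (X : flowType G) (x y : X) :
  x <> y -> exists U V, [/\ nbhs x U, nbhs y V & diagonal_nbhs (~` (U `*` V))].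
Proof.
move=> xy; have := @flow_hausdorff G X; rewrite open_hausdorff.
have /eqP xy' := xy.
move=> /(_ x y xy') [[O V]] /= [/set_mem Ox /set_mem Vy] [oO oV /eqP OV0].
have regX : {for x, @regular_space X}.
  by apply: (@compact_regular X x setT);
    [exact: flow_hausdorff|exact: flow_compact|exact: filterT].
have [U xU UO] := regX O (open_nbhs_nbhs (conj oO Ox)).
exists U, V; split=> //; first exact: open_nbhs_nbhs.
move=> w; have [/UO Ow|nUw] := pselect (closure U w).
  exists (setT, O) => /=; first by split; [exact: filterT|exact: open_nbhs_nbhs].
  by move=> -[s t]/= [_ Ot] [_ Vt]; have : (O `&` V) t by []; rewrite OV0.
exists (~` closure U, setT) => /=.
  split; last exact: filterT.
  by apply: open_nbhs_nbhs; split=> //; apply: closed_openC; exact: closed_closure.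
by move=> -[s t]/= [nUs _] [Us _]; apply: nUs; exact: subset_closure.
Qed.

(** * Equicontinuous extensions of proximal flows *)

Section EquicontinuousOverProximal.
Context {G : topologicalGroupType}.
Variables (Z Y Zs : minimalFlowType G) (sigma : Z -> Y) (sigmas : Zs -> Y).
Hypotheses (gs : gmap sigma) (gss : gmap sigmas) (pY : proximal_flow Y).
Hypothesis es : equicontinuous_map sigma.
Hypothesis mZs : minimal_ideal_flow Zs.
Hypothesis sep : forall z z' : Zs,
  (forall f : Zs -> Z, gmap f -> f z = f z') -> z = z'.

Let sigmasE (f : Zs -> Z) : gmap f -> sigmas =1 sigma \o f.
Proof. by move=> gf; apply: gmap_proximal_flow_eq => //; exact: gmap_comp gs gf. Qed.

Let sigmas_aut (k : flow_aut Zs) z : sigmas (k z) = sigmas z.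
Proof.
apply: (@gmap_proximal_flow_eq _ _ _ (sigmas \o k) sigmas) => //.
exact: gmap_comp gss (aut_gmap k).
Qed.

(** At some [g] the images under [f] become [A]-close; acting by [g^-1] then makes the original
    images [B]-close, against the choice of [B]. *)
Let distal z z' : sigmas z = sigmas z' -> proximal_pair z z' -> z = z'.
Proof.
move=> szz' pzz'; apply: sep => f gf; apply: contrapT => /separating_entourage.
move=> [U [V [zU z'V eB]]]; have [A eA AB] := es eB.
have [F FF [l [zl z'l]]] := proximal_gmap gf pzz'.
have nA : diagonal_nbhs A := eA.
have FA : F [set g | A (act g (f z), act g (f z'))] by exact: (cvg_pair zl z'l (nA l)).
have [g /= Ag] := filter_ex FA.
have := AB _ _ Ag _ (g^-1)%g; rewrite !actK => H.
apply: H; first by rewrite !gs.2 -![sigma (f _)]sigmasE // szz'.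
by split; exact: nbhs_singleton.
Qed.

Let fiber_aut z z' : sigmas z = sigmas z' <-> exists k : flow_aut Zs, k z = z'.
Proof.
split=> [szz'|[k <-]]; last by rewrite sigmas_aut.
have [k kz] := mZs z z'; exists k; apply: distal => //.
by rewrite sigmas_aut.
Qed.

Lemma equicontinuous_over_proximal : compact_group_extension sigmas.
Proof.
pose z0 := point_of Zs.
have rE : range (fiber_eval z0) = [set z | sigmas z = sigmas z0].
  apply/seteqP; split=> [_ [k _ <-]|z /= /esym/fiber_aut[k kz]].
    by rewrite /= /fiber_eval sigmas_aut.
  by exists k.
have cr : closed (range (fiber_eval z0)).
  rewrite rE; apply: closed_eq; [exact: flow_hausdorff|exact: gss.1|].
  by move=> z; exact: cvg_cst.
apply: (fiber_group_extension cr _ fiber_aut).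
apply: closed_graph_continuous.
- by apply: compactT_setX; [exact: fiber_group_compact|exact: flow_compact].
- by apply: hausdorff_setX; [exact: fiber_group_hausdorff|exact: flow_hausdorff].
- exact: flow_compact.
(* If [y] differs from [k x], some [f] separates them. By equicontinuity, a [k'] close to [k] at
   [z0] alone is close to it along the whole orbit of [z0], and that orbit comes near [x']. *)
move=> [[k x] y] c /=; apply: sep => f gf; apply: contrapT => /separating_entourage.
move=> [U [V [yU xV eB]]]; have [A eA AB] := es eB.
have nA : diagonal_nbhs A := eA.
have [[A1 A2] /= [kA1 kA2] A12] := nA (f (fiber_eval z0 k)).
pose N := [set k' : fiber_group z0 | A1 (f (fiber_eval z0 k'))].
have kN : nbhs (k : fiber_group z0) N.
  exact: (comp_continuous (@fiber_eval_continuous _ _ z0) gf.1 kA1).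
have xW : nbhs x ((f \o aut_fun k) @^-1` V).
  exact: (comp_continuous (aut_gmap k).1 gf.1 xV).
have yU' : nbhs y (f @^-1` U) by exact: gf.1.
have [|[[k' x'] y'] /= [-> [[/= Nk' Wx'] Uy']]] :=
    c ((N `*` ((f \o aut_fun k) @^-1` V)°) `*` (f @^-1` U)°).
  exists (N `*` ((f \o aut_fun k) @^-1` V)°, (f @^-1` U)°) => //; split=> /=.
    exists (N, ((f \o aut_fun k) @^-1` V)°) => //; split=> //.
    exact: nbhs_interior.
  exact: nbhs_interior.
have oO : open (((f \o aut_fun k) @^-1` V)° `&` (aut_fun k' @^-1` (f @^-1` U)°)).
  apply: openI; first exact: open_interior.
  by apply: open_comp; [move=> z _; exact: (aut_gmap k').1|exact: open_interior].
have [z [[Vz Uz] [g _ gz]]] := (@minimalP G Zs).2 z0 _ (ex_intro _ x' (conj Wx' Uy')) oO.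
have := AB (f (k' z0)) (f (k z0)) _ _ g; apply.
- by apply: A12; split=> //; exact: nbhs_singleton.
- by rewrite -![sigma (f _)]sigmasE // !sigmas_aut.
- rewrite -!gf.2 -(aut_gmap k').2 -(aut_gmap k).2 gz.
  by split; [exact: interior_subset Uz|exact: interior_subset Vz].
Qed.

End EquicontinuousOverProximal.

Lemma compact_extension_structure (G : topologicalGroupType)
    (Xs Y Z X : minimalFlowType G)
    (eta : Xs -> X) (iota : Xs -> Z) (sigma : Z -> Y) :
  gmap eta -> gmap iota -> gmap sigma -> proximal_flow Y -> proximal_map iota ->
  equicontinuous_map sigma ->
  exists (Xs Y Z : minimalFlowType G)
      (eta : Xs -> X) (iota : Xs -> Z) (sigma : Z -> Y),
    [/\ gmap eta, gmap iota & gmap sigma] /\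
    [/\ minimal_ideal_flow Xs, minimal_ideal_flow Y & minimal_ideal_flow Z]
    /\ [/\ proximal_flow Y, proximal_map iota &
           compact_group_extension sigma].
Proof.
move=> geta giota gsigma pY piota esigma.
have [W /ideal_flow_action[e ea]] := exists_ideal_flow Xs.
have mW := ideal_action_minimal_ideal ea.
have [egmap einj _ _] := ea.
(* Composition with automorphisms of [W] permutes the G-maps to [Z], so these automorphisms descend
   to the quotient by [R]. *)
pose R (w w' : W) := forall h : W -> Z, gmap h -> h w = h w'.
have [||||| Zs [q [gq sq qE]]] := @exists_quotient G W R.
- by [].
- by move=> w w' H h gh; rewrite H.
- by move=> w w' w'' H H' h gh; rewrite H // H'.
- have -> : [set z : W * W | R z.1 z.2] =
      \bigcap_(h in [set h : W -> Z | gmap h]) [set z | h z.1 = h z.2].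
    by apply/seteqP; split=> [z H h gh|z H h gh]; exact: H.
  apply: closed_bigI => h [ch _]; apply: closed_eq; first exact: flow_hausdorff.
  + exact: comp_continuous (@fst_continuous _ _) ch.
  + exact: comp_continuous (@snd_continuous _ _) ch.
- by move=> g w w' H h gh; rewrite !gh.2 H.
have lift (h : W -> Z) : gmap h -> exists2 f : Zs -> Z, gmap f & forall w, f (q w) = h w.
  move=> gh; apply: exists_factor => // w w' /qE; exact.
have lift_aut (s : flow_aut W) : exists2 f : Zs -> Zs, gmap f & forall w, f (q w) = q (s w).
  apply: (exists_factor (f := q \o s)) => //; first exact: gmap_comp gq (aut_gmap s).
  by move=> w w' /qE H; apply/qE => h gh; exact: (H _ (gmap_comp gh (aut_gmap s))).
have mZs : minimal_ideal_flow Zs.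
  move=> z z'; have [w <-] := sq z; have [w' <-] := sq z'.
  have [s sw] := mW w w'.
  have [f gf fE] := lift_aut s; have [f' gf' f'E] := lift_aut (flow_autV s).
  have fK : cancel f f' by move=> y; have [v <-] := sq y; rewrite fE f'E /= aut_funK.
  have f'K : cancel f' f by move=> y; have [v <-] := sq y; rewrite f'E fE /= aut_invK.
  by exists (FlowAut gf gf' fK f'K) => /=; rewrite fE; exact: proximal_gmap.
pose x0 := point_of Xs.
have [f0 gf0 f0E] := lift _ (gmap_comp giota (egmap x0)).
exists W, Y, Zs, (eta \o e^~ x0), q, (sigma \o f0); split; first split=> //.
- exact: gmap_comp geta (egmap x0).
- exact: gmap_comp gsigma gf0.
(* On a proximal flow the identity already makes any two points proximal. *)
split; first by split=> // y y'; exists (flow_aut1 Y); exact: pY.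
split=> //.
(* Each [iota \o e^~ x] takes the same value at [w] and [w'], hence is unchanged by [s]. Proximality
   of [iota] then makes [e (s w) x] and [e w x] proximal, which forces equality. *)
- move=> w w' /qE ww'; have [s sw] := mW w w'.
  suff <- : s w = w by [].
  apply: einj => x.
  apply: (@gmap_proximal_eq _ _ _ ((fun m => e m x) \o s) (fun m => e m x) w) => //.
    exact: gmap_comp (egmap x) (aut_gmap s).
  have gi := gmap_comp giota (egmap x).
  apply: piota.
  apply: (@gmap_proximal_eq _ _ _ ((iota \o e^~ x) \o s) (iota \o e^~ x) w) => //.
    exact: gmap_comp gi (aut_gmap s).
  by rewrite [X in proximal_pair _ X](ww' _ gi); exact: (proximal_gmap gi sw).
- apply: (equicontinuous_over_proximal gsigma _ pY esigma mZs).
    exact: gmap_comp gsigma gf0.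
  move=> z z'; have [w <-] := sq z; have [w' <-] := sq z' => H.
  apply/qE => h gh; have [f gf fE] := lift _ gh.
  by rewrite -!fE; exact: H.
Qed.

(** [J] covers both [Xs] and [M]. Each coordinate of its map to [M] is a G-map to [X], hence [eta]
    after the map to [Xs] after an automorphism of [J]; the latter descends to [Xs], so the map to
    [M] factors through [Xs]. *)
Lemma exists_gmap_ideal (G : topologicalGroupType) (Xs X M : minimalFlowType G)
    (eta : Xs -> X) : minimal_ideal_flow Xs -> gmap eta -> is_ideal_flow_of X M ->
  exists theta : Xs -> M, gmap theta.
Proof.
move=> mXs geta /ideal_flow_action[e [egmap einj _ _]].
pose P : flowType G := (Xs * M)%type.
have [J /ideal_flow_action[d da]] := exists_ideal_flow P.
have mJ := ideal_action_minimal_ideal da.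
have [dgmap _ _ _] := da.
pose z0 : P := (point_of Xs, point_of M).
have ga : gmap (fst \o d^~ z0) by exact: gmap_comp (@gmap_fst G Xs M) (dgmap z0).
have gm : gmap (snd \o d^~ z0) by exact: gmap_comp (@gmap_snd G Xs M) (dgmap z0).
have sa x : exists j, (fst \o d^~ z0) j = x by exact: (gmap_surj (point_of J) ga).
have [|theta gtheta _] := exists_factor ga sa gm; last by exists theta.
move=> j j' ajj'; apply: einj => x.
have [s sE] := factor_through_aut mJ (gmap_comp geta ga) (gmap_comp (egmap x) gm).
have [s' s'E] := aut_through_factor mXs ga (gmap_comp ga (aut_gmap s)).
have := sE j; have := sE j'; rewrite /= => -> ->; congr eta.
have := s'E j; have := s'E j'; rewrite /= => -> ->.
by rewrite [(d j z0).1]ajj'.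
Qed.

Lemma compact_extension_hausdorff (G : topologicalGroupType)
    (X M Xs Y Z : minimalFlowType G)
    (eta : Xs -> X) (iota : Xs -> Z) (sigma : Z -> Y) :
  is_ideal_flow_of X M -> gmap eta -> gmap iota -> gmap sigma ->
  minimal_ideal_flow Xs -> minimal_ideal_flow Z ->
  proximal_flow Y -> proximal_map iota -> compact_group_extension sigma ->
  hausdorff_space (ellis_group M).
Proof.
move=> idM geta giota gsigma mXs mZ pY piota [K [a [[cK hK] [_ _ ca] autK sigmaE]]].
have [e ea] := ideal_flow_action idM.
have mM := ideal_action_minimal_ideal ea.
have [theta gtheta] := exists_gmap_ideal mXs geta idM.
have [h hE] := exists_induced mM gtheta.
have [i iE] := exists_induced mZ giota.
(* Two automorphisms with equal images differ at each point only within a fiber of the proximal map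
   [iota]. *)
have i_inj : injective i.
  move=> p q ipq; apply: flow_autP.
  apply: (@gmap_proximal_eq _ _ _ _ _ (point_of Xs)); try exact: aut_gmap.
  by apply: piota; rewrite !iE ipq.
have i_surj := induced_surj mXs giota iE.
pose i' q := projT1 (cid (i_surj q)).
have i'K q : i (i' q) = q by rewrite /i'; case: cid.
have iK p : i' (i p) = p by apply: i_inj; rewrite i'K.
pose kappa (k : K) : ellis_group Z := projT1 (cid (autK k)).
have kappaE k z : kappa k z = a k z by rewrite /kappa; case: cid => p /= ->.
pose z0 := point_of Z.
(* Maps into the proximal flow [Y] are unique, so [p] preserves [sigma] and [p z0] lies in the
   [K]-orbit of [z0]. *)
have kappa_surj (p : ellis_group Z) : exists k, kappa k = p.
  have /sigmaE[k kz] : sigma z0 = sigma (p z0).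
    apply: (@gmap_proximal_flow_eq _ _ _ sigma (sigma \o p)) => //.
    exact: gmap_comp gsigma (aut_gmap p).
  by exists k; apply: (@aut_eq _ _ _ _ z0); rewrite kappaE.
(* The graphs of all [kappa k] with [k] in [C] together fill the closed image [D] of a compact set,
   so taking the closure adds no points. *)
have kappa_closed C : closed C -> closed (kappa @` C).
  move=> cC; rewrite closure_id; apply/seteqP; split; first exact: subset_closure.
  rewrite closure_tauE => p pC.
  pose D := (fun kz : K * Z => (kz.2, a kz.1 kz.2)) @` (fst @^-1` C).
  have cD : closed D.
    apply: closed_image.
    - by apply: compactT_setX => //; exact: flow_compact.
    - by apply: hausdorff_setX; exact: flow_hausdorff.
    - by apply: pair_continuous => //; exact: snd_continuous.
    - by apply: preimage_closed => // kz _; exact: fst_continuous.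
  have CD : closure (\bigcup_(q in kappa @` C) graph q) `<=` D.
    apply: (subset_trans _ cD); apply: closureS => _ [_ [k Ck <-] [z _ <-]].
    by exists (k, z) => //=; rewrite kappaE.
  have [[k z] Ck [zE kz]] : D (z0, p z0) by apply/CD/pC; exists z0.
  exists k => //; apply: (@aut_eq _ _ _ _ z0).
  by rewrite kappaE -kz -[in LHS]zE.
have kappa_continuous : continuous kappa.
  apply/continuous_closedP => C cC; rewrite closure_id; apply/seteqP.
  split; first exact: subset_closure.
  move=> k kC; apply: cC; apply: (@graphs_closure_closure _ _ _ _ z0).
  rewrite kappaE => U zU.
  have ck : continuous (fun k : K => (z0, a k z0)).
    apply: pair_continuous; first exact: cst_continuous.
    apply: (comp_continuous (f := fun k : K => (k, z0)) _ ca).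
    by apply: pair_continuous; [move=> ?; exact: cvg_id|exact: cst_continuous].
  have [k' [Ck' Uk']] := kC _ (ck k _ zU).
  exists (z0, a k' z0); split=> //.
  by exists (kappa k') => //; exists z0 => //; rewrite kappaE.
have i'_closed C : closed C -> closed (i' @` C).
  have -> : i' @` C = i @^-1` C.
    apply/seteqP; split=> [_ [q Cq <-]|p Cp]; first by rewrite /preimage/= i'K.
    by exists (i p).
  by move=> cC; apply: preimage_closed => // p _; exact: induced_continuous iE _.
have i'_continuous : continuous i'.
  apply/continuous_closedP => C cC.
  have -> : i' @^-1` C = i @` C.
    apply/seteqP; split=> [q Cq|_ [p Cp <-]]; last by rewrite /preimage/= iK.
    by exists (i' q).
  exact: (induced_closed mXs giota iE).
apply: (closed_onto_hausdorff (f := h \o (i' \o kappa)) cK hK).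
- apply: comp_continuous (comp_continuous kappa_continuous i'_continuous) _.
  exact: induced_continuous gtheta _ hE.
- move=> C cC; rewrite -image_comp -[X in h @` X]image_comp.
  by apply: (induced_closed mXs gtheta hE); apply: i'_closed; exact: kappa_closed.
- move=> p; have [q <-] := induced_surj mXs gtheta hE p.
  have [k kq] := kappa_surj (i q).
  by exists k; rewrite /= kq iK.
Qed.

Theorem theorem8p13 (G : topologicalGroupType) (hG : hausdorff_space G)
    (X : minimalFlowType G)
    (M : minimalFlowType G) (hM : is_ideal_flow_of X M) :
  [<->
    hausdorff_space (ellis_group M);

    exists (Xs Y Z : minimalFlowType G)
        (eta : Xs -> X) (iota : Xs -> Z) (sigma : Z -> Y),
      [/\ gmap eta, gmap iota & gmap sigma] /\
      [/\ proximal_flow Y, proximal_map eta, proximal_map iota &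
          equicontinuous_map sigma];

    exists (Xs Y Z : minimalFlowType G)
        (eta : Xs -> X) (iota : Xs -> Z) (sigma : Z -> Y),
      [/\ gmap eta, gmap iota & gmap sigma] /\
      [/\ proximal_flow Y, proximal_map iota & equicontinuous_map sigma];

    exists (Xs Y Z : minimalFlowType G)
        (eta : Xs -> X) (iota : Xs -> Z) (sigma : Z -> Y),
      [/\ gmap eta, gmap iota & gmap sigma] /\
      [/\ minimal_ideal_flow Xs, minimal_ideal_flow Y & minimal_ideal_flow Z]
      /\ [/\ proximal_flow Y, proximal_map iota &
             compact_group_extension sigma]
  ].
Proof.
tfae.
- have [e ea] := ideal_flow_action hM; have [egmap _ _ _] := ea.
  exact: hausdorff_structure (ideal_action_minimal_ideal ea) (egmap (point_of X)).
- move=> [Xs [Y [Z [eta [iota [sigma [gmaps [pY _ pi es]]]]]]]].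
  by exists Xs, Y, Z, eta, iota, sigma.
- move=> [Xs [Y [Z [eta [iota [sigma [[ge gi gs] [pY pi es]]]]]]]].
  exact: compact_extension_structure ge gi gs pY pi es.
- move=> [Xs [Y [Z [eta [iota [sigma [[ge gi gs] [[mXs _ mZ] [pY pi cs]]]]]]]]].
  exact: compact_extension_hausdorff hM ge gi gs mXs mZ pY pi cs.
Qed.
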